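(* Let $G$ be a group generated by a finite set $X$ and hyperbolic relative to a collection of subgroups $\{H_1,\ldots,H_m\}$. Let $R$ be a subgroup of $G$. Then the following conditions are equivalent. 1) $R$ is strongly relatively quasi-convex. 2) $R$ is generated by a finite set $Y$ and the natural embedding $(R,dist_Y)\to(G,dist_{X\cup\mathcal H})$ is a quasi-isometric embedding.
   Context: Relative hyperbolicity. Let $X$ be a finite set generating $G$ relative to $\{H_1,\dots,H_m\}$, i.e. $G$ is generated by $X\cup H_1\cup\dots\cup H_m$. Put $F=\widetilde H_1\ast\dots\ast\widetilde H_m\ast F(X)$, where $\widetilde H_i$ is an isomorphic copy of $H_i$ and $F(X)$ is free with basis $X$, and $\mathcal H=\bigsqcup_i(\widetilde H_i\setminus\{1\})$. $G$ has a finite relative presentation $\langle X,H_1,\dots,H_m\mid R=1,R\in\mathcal R\rangle$ if $\mathcal R$ is a finite set of words over $X^{\pm1}\cup\mathcal H$ (closed under cyclic shifts and inverses) whose normal closure in $F$ is the kernel of the canonical epimorphism $F\to G$. Its relative Dehn function is the smallest function $f$ such that every word $W$ over $X^{\pm1}\cup\mathcal H$ of length at most $n$ representing $1$ in $G$ equals in $F$ a product $\prod_{i=1}^kf_i^{-1}R_if_i$ with $R_i\in\mathcal R$, $f_i\in F$, $k\le f(n)$. $G$ is hyperbolic relative to $\{H_1,\dots,H_m\}$ if it has a finite relative presentation whose relative Dehn function is bounded from above by $Ln$ for some constant $L$. Metrics. For a finite generating set $X$ of $G$ (in the ordinary sense), $dist_X$ is the word metric on $G$ with respect to $X$; $\Gamma(G,X\cup\mathcal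 H)$ is the Cayley graph of $G$ with respect to the generating set $X\cup H_1\cup\dots\cup H_m$, with edges of length $1$, and $dist_{X\cup\mathcal H}$ is the corresponding metric. For a group $R$ generated by $Y$, $dist_Y$ is the word metric on $R$. Quasi-convexity. A subgroup $R\le G$ is relatively quasi-convex with respect to $\{H_1,\dots,H_m\}$ if there is a constant $\sigma>0$ such that for any $f,g\in R$, any geodesic path $p$ from $f$ to $g$ in $\Gamma(G,X\cup\mathcal H)$, and any vertex $v\in p$ there is $w\in R$ with $dist_X(v,w)\le\sigma$. It is strongly relatively quasi-convex if, in addition, $R\cap H_i^g$ is finite for all $i=1,\dots,m$ and $g\in G$, where $H_i^g=g^{-1}H_ig$. A map $\iota:(M_1,dist_1)\to(M_2,dist_2)$ is a quasi-isometric embedding if there are $c_1,c_2>0$ with $\frac1{c_1}dist_1(x,y)-c_2\le dist_2(\iota(x),\iota(y))\le c_1dist_1(x,y)+c_2$ for all $x,y\in M_1$. *)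

(* Defs.v *)
From HB Require Import structures.
From mathcomp Require Import all_boot all_order all_algebra.
From mathcomp Require Import generic_quotient.
From mathcomp Require Import boolp classical_sets cardinality reals.

Set Implicit Arguments.
Unset Strict Implicit.
Unset Printing Implicit Defensive.

Import Order.TTheory GRing.Theory Num.Theory.

Local Open Scope classical_set_scope.
Local Open Scope group_scope.
Local Open Scope quotient_scope.

(* Subgroups of a (possibly infinite) group G are terms of [groupClosed G].
   These are boolean predicates, but by the axioms of [boolp] every subset of G
   is of this form. *)

Section WordMetric.
Context {G : groupType}.
Implicit Types (S : set G) (a b g : G) (w : seq G).

Definition word_over S w : Prop :=
  forall s, s \in w -> S s \/ S s^-1.

Definition spells S w g : Prop := word_over S w /\ \prod_(s <- w) s = g.

Definition generated S : set G := [set g | exists w, spells S w g].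

Definition has_word_of_size S g : pred nat :=
  fun n => `[< exists2 w, spells S w g & size w = n >].

(* The value 0 taken when g is not in [generated S] is a dummy. *)
Definition word_length S g : nat :=
  if pselect (exists n, has_word_of_size S g n) is left e then ex_minn e else 0.

Definition word_dist S a b : nat := word_length S (a^-1 * b).

(* A path in the Cayley graph is given by its origin and the sequence of its
   other vertices, as in [path]; its length is the size of this sequence. *)
Definition cayley S : rel G :=
  fun a b => `[< S (a^-1 * b) \/ S (b^-1 * a) >].

Definition cayley_path S a b (p : seq G) : Prop :=
  path (cayley S) a p /\ last a p = b.

Definition cayley_geodesic S a b (p : seq G) : Prop :=
  cayley_path S a b p /\ forall q, cayley_path S a b q -> size p <= size q.

End WordMetric.

Definition normal_subgroup (T : groupType) (N : groupClosed T) : Prop :=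
  forall x y : T, x \in N -> x ^ y \in N.

Definition normal_closure (T : groupType) (A : set T) : set T :=
  [set x | forall N : groupClosed T,
     normal_subgroup N -> A `<=` [set` N] -> x \in N].

Section FreeProduct.
Context {G : groupType} (X : set G) {m : nat} (H : 'I_m -> groupClosed G).

(* [Gen x false] is x and [Gen x true] is the formal inverse of x. *)
Inductive letter : Type :=
| Gen of X & bool
| Par (i : 'I_m) of {h : G | (h \in H i) && (h != 1)}.

HB.instance Definition _ := gen_eqMixin letter.
HB.instance Definition _ := gen_choiceMixin letter.

Notation word := (seq letter).

Definition letter_val (l : letter) : G :=
  match l with
  | Gen x b => if b then (val x)^-1 else val x
  | Par i h => val h
  end.

Definition word_val (w : word) : G := \prod_(l <- w) letter_val l.

Lemma par_invP i (h : {h : G | (h \in H i) && (h != 1)}) :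
  ((val h)^-1 \in H i) && ((val h)^-1 != 1).
Proof. by case: h => h /= /andP[hH h1]; rewrite gpredV hH /= invg_eq1. Qed.

Definition letter_inv (l : letter) : letter :=
  match l with
  | Gen x b => Gen x (~~ b)
  | Par i h => @Par i (exist _ (val h)^-1 (par_invP h))
  end.

Definition word_inv (w : word) : word := rev (map letter_inv w).

(* The free product F of the copies of the H_i and of the free group with basis
   X is the free monoid on the letters modulo the relations that hold in each
   factor. *)
Inductive fp_rule : word -> word -> Prop :=
| fp_free x b : fp_rule [:: Gen x b; Gen x (~~ b)] [::]
| fp_mul i (h k l : {h : G | (h \in H i) && (h != 1)}) :
    val h * val k = val l -> fp_rule [:: Par h; Par k] [:: Par l]
| fp_inv i (h k : {h : G | (h \in H i) && (h != 1)}) :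
    val h * val k = 1 -> fp_rule [:: Par h; Par k] [::].

Inductive fp_eq : word -> word -> Prop :=
| fp_step u v r s : fp_rule r s -> fp_eq (u ++ r ++ v) (u ++ s ++ v)
| fp_refl w : fp_eq w w
| fp_sym v w : fp_eq v w -> fp_eq w v
| fp_trans u v w : fp_eq u v -> fp_eq v w -> fp_eq u w.

Definition fp_eqb : rel word := fun v w => `[< fp_eq v w >].

Lemma fp_eqb_refl : reflexive fp_eqb.
Proof. by move=> w; apply/asboolP; exact: fp_refl. Qed.

Lemma fp_eqb_sym : symmetric fp_eqb.
Proof. by move=> v w; apply/asboolP/asboolP; exact: fp_sym. Qed.

Lemma fp_eqb_trans : transitive fp_eqb.
Proof.
move=> v u w /asboolP uv /asboolP vw; apply/asboolP; exact: fp_trans uv vw.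
Qed.

Canonical fp_equiv := EquivRel fp_eqb fp_eqb_refl fp_eqb_sym fp_eqb_trans.

Definition free_product : Type := {eq_quot fp_equiv}.
HB.instance Definition _ := Choice.on free_product.
HB.instance Definition _ := Quotient.on free_product.

Definition fp_class (w : word) : free_product := \pi_free_product w.

Lemma fp_classP v w : fp_class v = fp_class w <-> fp_eq v w.
Proof.
split=> [/(@eqmodP _ fp_equiv) /asboolP //|vw].
by apply/(@eqmodP _ fp_equiv)/asboolP.
Qed.

Lemma fp_repr (w : word) : fp_eq (repr (fp_class w)) w.
Proof. by apply/fp_classP; rewrite /fp_class reprK. Qed.

Lemma fp_eq_cat2l u v w : fp_eq v w -> fp_eq (u ++ v) (u ++ w).
Proof.
elim=> {v w} [x y r s rs|w|v w _ vw|x v w _ xv _ vw].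
- by rewrite !(catA u); exact: fp_step.
- exact: fp_refl.
- exact: fp_sym.
- exact: fp_trans xv vw.
Qed.

Lemma fp_eq_cat2r u v w : fp_eq v w -> fp_eq (v ++ u) (w ++ u).
Proof.
elim=> {v w} [x y r s rs|w|v w _ vw|x v w _ xv _ vw].
- by rewrite -!catA; exact: fp_step.
- exact: fp_refl.
- exact: fp_sym.
- exact: fp_trans xv vw.
Qed.

Lemma fp_eq_cat u u' v v' : fp_eq u u' -> fp_eq v v' -> fp_eq (u ++ v) (u' ++ v').
Proof.
by move=> uu' vv'; apply: fp_trans (fp_eq_cat2r v uu') (fp_eq_cat2l u' vv').
Qed.

Lemma fp_invl w : fp_eq (word_inv w ++ w) [::].
Proof.
elim: w => [|l w IHw]; first exact: fp_refl.
rewrite /word_inv /= rev_cons -cats1 -catA /= -/(word_inv w).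
apply: fp_trans IHw; rewrite -[X in fp_eq _ (_ ++ X)]cat0s.
apply: (fp_step _ _ (r := [:: letter_inv l; l])).
case: l => [x b|i h] /=; last by apply: fp_inv => /=; rewrite mulVg.
by rewrite -{2}[b]negbK; exact: fp_free.
Qed.

Lemma letter_invK : involutive letter_inv.
Proof.
case=> [x b|i h] /=; first by rewrite negbK.
by congr (Par _); apply: val_inj; rewrite /= invgK.
Qed.

Lemma word_invK : involutive word_inv.
Proof.
by move=> w; rewrite /word_inv map_rev revK -map_comp (eq_map letter_invK) map_id.
Qed.

Lemma fp_invr w : fp_eq (w ++ word_inv w) [::].
Proof. by rewrite -{1}[w]word_invK; exact: fp_invl. Qed.

Lemma fp_eq_inv v w : fp_eq v w -> fp_eq (word_inv v) (word_inv w).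
Proof.
move=> vw; apply: fp_trans (_ : fp_eq _ (word_inv v ++ w ++ word_inv w)) _.
  rewrite -{1}[word_inv v]cats0; apply: fp_eq_cat2l; exact/fp_sym/fp_invr.
rewrite catA; apply: (fp_eq_cat2r _ (w := [::])).
apply: fp_trans (fp_invl v); exact/fp_eq_cat2l/fp_sym.
Qed.

Definition fp_one : free_product := fp_class [::].
Definition fp_prod (a b : free_product) : free_product :=
  fp_class (repr a ++ repr b).
Definition fp_opp (a : free_product) : free_product :=
  fp_class (word_inv (repr a)).

Lemma fp_class_cat v w : fp_class (v ++ w) = fp_prod (fp_class v) (fp_class w).
Proof. by apply/fp_classP/fp_sym/fp_eq_cat; exact: fp_repr. Qed.

Lemma fp_class_inv w : fp_class (word_inv w) = fp_opp (fp_class w).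
Proof. by apply/fp_classP/fp_sym/fp_eq_inv; exact: fp_repr. Qed.

Lemma fp_class_surj (a : free_product) : exists w, a = fp_class w.
Proof. by exists (repr a); rewrite /fp_class reprK. Qed.

Lemma fp_prodA : associative fp_prod.
Proof.
move=> a b c; case: (fp_class_surj a) (fp_class_surj b) (fp_class_surj c).
by move=> u -> [v ->] [w ->]; rewrite -!fp_class_cat catA.
Qed.

Lemma fp_prod1 : left_id fp_one fp_prod.
Proof. by move=> a; case: (fp_class_surj a) => u ->; rewrite -fp_class_cat. Qed.

Lemma fp_prodr1 : right_id fp_one fp_prod.
Proof.
by move=> a; case: (fp_class_surj a) => u ->; rewrite -fp_class_cat cats0.
Qed.

Lemma fp_prodV : left_inverse fp_one fp_opp fp_prod.
Proof.
move=> a; case: (fp_class_surj a) => u ->.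
by rewrite -fp_class_inv -fp_class_cat; apply/fp_classP/fp_invl.
Qed.

Lemma fp_prodrV : right_inverse fp_one fp_opp fp_prod.
Proof.
move=> a; case: (fp_class_surj a) => u ->.
by rewrite -fp_class_inv -fp_class_cat; apply/fp_classP/fp_invr.
Qed.

HB.instance Definition _ := isGroup.Build free_product
  fp_prodA fp_prod1 fp_prodr1 fp_prodV fp_prodrV.

Definition fp_val (a : free_product) : G := word_val (repr a).

Lemma fp_eq_val v w : fp_eq v w -> word_val v = word_val w.
Proof.
rewrite /word_val; elim=> {v w} [u v r s rs|//|v w _ //|u v w _ -> _ -> //].
rewrite !big_cat /=; congr (_ * (_ * _)).
case: rs => [x b|i h k l e|i h k e]; rewrite !(big_cons, big_nil) mulg1 /=.
- by case: b; rewrite ?mulVg ?mulgV.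
- by rewrite e mulg1.
- by rewrite e.
Qed.

Lemma fp_val_class w : fp_val (fp_class w) = word_val w.
Proof. exact/fp_eq_val/fp_repr. Qed.

Lemma fp_valM (a b : free_product) : fp_val (a * b) = fp_val a * fp_val b.
Proof. by rewrite [LHS]fp_val_class /word_val big_cat. Qed.

Definition symmetrized (Rel : set word) : Prop :=
  (forall w n, Rel w -> Rel (rot n w)) /\ (forall w, Rel w -> Rel (word_inv w)).

Definition finite_relative_presentation (Rel : set word) : Prop :=
  [/\ finite_set Rel, symmetrized Rel &
      normal_closure (fp_class @` Rel) = [set a | fp_val a = 1]].

(* The pair (f, r) of s stands for the factor f^-1 r f. *)
Definition dehn_bound (Rel : set word) (f : nat -> nat) : Prop :=
  forall n w, size w <= n -> word_val w = 1 ->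
    exists s : seq (free_product * word),
      [/\ forall p, p \in s -> Rel p.2,
          fp_class w = \prod_(p <- s) fp_class p.2 ^ p.1 & size s <= f n].

Definition relative_dehn_function (Rel : set word) (f : nat -> nat) : Prop :=
  dehn_bound Rel f /\ forall f', dehn_bound Rel f' -> forall n, f n <= f' n.

End FreeProduct.

Section RelativeHyperbolicity.
Context (K : realType) {G : groupType} {m : nat} (H : 'I_m -> groupClosed G).
Implicit Types (X Y : set G) (R : groupClosed G).
Local Open Scope ring_scope.

Definition relative_generators X : set G := X `|` \bigcup_i [set` H i].

(* Relative hyperbolicity is a property of G and the H_i alone: the finite
   relative generating set is part of the data of the presentation. *)
Definition relatively_hyperbolic : Prop :=
  exists (X : set G) (Rel : set (seq (letter X H))),
    [/\ finite_set X, generated (relative_generators X) = setT,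
        finite_relative_presentation Rel &
        exists (f : nat -> nat) (L : K),
          relative_dehn_function Rel f /\ forall n, (f n)%:R <= L * n%:R].

Definition relatively_quasiconvex X R : Prop :=
  exists2 sigma : K, 0 < sigma &
    forall f g p v, f \in R -> g \in R ->
      cayley_geodesic (relative_generators X) f g p -> v \in f :: p ->
      exists2 w, w \in R & (word_dist X v w)%:R <= sigma.

Definition strongly_relatively_quasiconvex X R : Prop :=
  relatively_quasiconvex X R /\
  forall i g, finite_set ([set` R] `&` [set (h ^ g)%g | h in [set` H i]]).

End RelativeHyperbolicity.

Definition quasi_isometric_embedding (K : realType) (M1 M2 : Type)
    (dist1 : M1 -> M1 -> K) (dist2 : M2 -> M2 -> K) (iota : M1 -> M2) : Prop :=
  exists c1 c2 : K, [/\ 0 < c1, 0 < c2 &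
    forall x y, c1^-1 * dist1 x y - c2 <= dist2 (iota x) (iota y)
             /\ dist2 (iota x) (iota y) <= c1 * dist1 x y + c2]%R.

(* Main.v *)
(* Van Kampen diagrams are replaced by cochains: a function of labelled edges of
   the Cayley graph that respects the relations of the free product and is
   bounded on relators has a sum along any loop that is linear in the length of
   the loop, because the relative Dehn function is linear.

   2) => 1).  For functions f and h that are Lipschitz for the relative metric,
   the "area form" (h x + h y)(f y - f x) is such a cochain up to an error linear
   in the length.  Let D be the largest distance from a point of a geodesic p with
   ends in R to R, attained at v.  A loop of length O(D) is made of the part of p
   within 2D of v, two shortest paths to R, and a path that stays near R, which
   exists since R is quasi-isometrically embedded.  With f the distance to the
   origin of p and h a bump of radius about D around v, the area along p is at
   least about D^2 and it vanishes on the rest of the loop, so D is bounded.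
   Next, a truncated word metric on one coset of H_i, for the finitely many
   letters of H_i in the relators, is also such a cochain.  Hence an H_i-edge
   of a loop that is the only one in its coset lies in a finite set that depends on
   the length of the loop only.  This bounds the H_i-edges of p, and then those of
   a shortest path from v to R, in the metric of X.

   1) => 2).  Jump from the vertices of a geodesic to nearby points of R.  The jumps
   have the form a^-1 s b with a, b in a ball of X and s in X or in some H_i, and
   two jumps with the same a, b, i differ by an element of R and of a conjugate
   of H_i, so there are finitely many of them. *)

Require Import Defs.
From mathcomp Require Import all_boot all_order all_algebra.
From mathcomp Require Import boolp classical_sets cardinality reals.
From mathcomp Require Import zify.

Set Implicit Arguments.
Unset Strict Implicit.
Unset Printing Implicit Defensive.

Import Order.TTheory GRing.Theory Num.Theory.

Lemma finite_set_bounded (T : eqType) (A : set T) (F : T -> nat) :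
  finite_set A -> exists k, forall x, A x -> F x <= k.
Proof.
case/finite_seqP => s ->; exists (\max_(x <- s) F x) => x /= xs.
by rewrite (big_rem x xs) /= leq_maxl.
Qed.

Lemma nat_upper_bound (K : realType) (c : K) : exists n : nat, (c <= n%:R)%R.
Proof.
exists (Num.truncn `|c|%R).+1; apply: le_trans (ler_norm c) _.
exact/ltW/archimedean.Num.Theory.truncnS_gt.
Qed.

(** * Word lengths *)

Section WordLength.
Local Open Scope classical_set_scope.
Local Open Scope group_scope.
Context {G : groupType}.
Implicit Types (S : set G) (a b g : G) (v w : seq G).

Lemma spells_nil S : spells S [::] 1.
Proof. by split=> //; rewrite big_nil. Qed.

Lemma spells1 S a : S a \/ S a^-1 -> spells S [:: a] a.
Proof. by move=> Sa; split=> [s|]; rewrite ?inE ?big_seq1 // => /eqP ->. Qed.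

Lemma spells_cat S v w a b :
  spells S v a -> spells S w b -> spells S (v ++ w) (a * b).
Proof.
move=> [Sv <-] [Sw <-]; split; last by rewrite big_cat.
by move=> s; rewrite mem_cat => /orP[/Sv|/Sw].
Qed.

Lemma spells_inv S w a : spells S w a -> spells S (rev [seq s^-1 | s <- w]) a^-1.
Proof.
case=> Sw <-; split.
  by move=> s; rewrite mem_rev => /mapP[t /Sw [] St ->]; rewrite invgK; [right|left].
elim: w {Sw} => [|s w IHw]; first by rewrite !big_nil invg1.
by rewrite /= rev_cons -cats1 big_cat /= IHw big_seq1 big_cons invgM.
Qed.

Lemma spells_sub (S S' : set G) w a : S `<=` S' -> spells S w a -> spells S' w a.
Proof. by move=> SS' [Sw aE]; split=> // s /Sw [] /SS'; [left|right]. Qed.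

Lemma word_length_le S w g : spells S w g -> word_length S g <= size w.
Proof.
move=> wg; have wn : has_word_of_size S g (size w) by apply/asboolP; exists w.
rewrite /word_length; case: pselect => [e|[]]; last by exists (size w).
by case: ex_minnP => n _; apply.
Qed.

Lemma word_lengthP S g :
  generated S g -> exists2 w, spells S w g & size w = word_length S g.
Proof.
case=> w wg; rewrite /word_length; case: pselect => [e|[]].
  by case: ex_minnP => n /asboolP [w' w'g <-] _; exists w'.
by exists (size w); apply/asboolP; exists w.
Qed.

Lemma generated1 S : generated S 1.
Proof. by exists [::]; exact: spells_nil. Qed.

Lemma generatedM S a b : generated S a -> generated S b -> generated S (a * b).
Proof. by case=> v va [w wb]; exists (v ++ w); exact: spells_cat. Qed.

Lemma generatedV S a : generated S a -> generated S a^-1.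
Proof. by case=> v /spells_inv va; eexists; exact: va. Qed.

Lemma word_length1 S : word_length S 1 = 0.
Proof. by have := word_length_le (spells_nil S); rewrite leqn0 => /eqP. Qed.

Lemma word_lengthM S a b : generated S a -> generated S b ->
  word_length S (a * b) <= word_length S a + word_length S b.
Proof.
move=> /word_lengthP[v va <-] /word_lengthP[w wb <-].
by rewrite -size_cat; apply/word_length_le/spells_cat.
Qed.

Lemma word_lengthV S a : generated S a -> word_length S a^-1 = word_length S a.
Proof.
have leV b : generated S b -> word_length S b^-1 <= word_length S b.
  move=> /word_lengthP[v vb <-].
  by have := word_length_le (spells_inv vb); rewrite size_rev size_map.
move=> Sa; apply/eqP; rewrite eqn_leq leV //=.
by rewrite -{1}[a]invgK leV //; exact: generatedV.
Qed.

Lemma generated_sub_group S (R : groupClosed G) :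
  S `<=` [set` R] -> generated S `<=` [set` R].
Proof.
move=> SR g [w [Sw <-]]; rewrite /= big_seq; apply: gpred_prod => s /Sw [] /SR //.
by rewrite /= gpredV.
Qed.

Lemma ball_finite S n :
  finite_set S -> finite_set [set g | generated S g /\ word_length S g <= n].
Proof.
move=> finS; pose T := S `|` [set s^-1 | s in S].
have finT : finite_set T by rewrite finite_setU; split=> //; exact: finite_image.
have finW : forall k, finite_set [set g | exists2 w, spells S w g & size w = k].
  elim=> [|k IHk].
    apply: sub_finite_set (finite_set1 1) => g [w [_ <-]] /size0nil ->.
    by rewrite big_nil.
  apply: sub_finite_set (finite_image2 (fun s g => s * g) finT IHk) => g.
  case=> [[|s w]] // [Sw <-] [wk].
  have Ss : S s \/ S s^-1 by apply: Sw; rewrite inE eqxx.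
  exists s; first by case: Ss => ?; [left|right; exists s^-1; rewrite ?invgK].
  exists (\prod_(t <- w) t); last by rewrite big_cons.
  by exists w => //; split=> // t tw; apply: Sw; rewrite inE tw orbT.
have := bigcup_finite (finite_II n.+1) (fun k _ => finW k).
apply: sub_finite_set => g [/word_lengthP[w wg <-] len_w].
by exists (size w) => //; exists w.
Qed.

End WordLength.

(** * Sums of edge functions along words *)

Section Words.
Local Open Scope classical_set_scope.
Local Open Scope group_scope.
Context {G : groupType} (X : set G) {m : nat} (H : 'I_m -> groupClosed G).
Implicit Types (u v w : seq (letter X H)) (l : letter X H) (g : G).
Notation S := (relative_generators H X).

Lemma word_val_nil : word_val ([::] : seq (letter X H)) = 1.
Proof. by rewrite /word_val big_nil. Qed.

Lemma word_val_cons l w : word_val (l :: w) = letter_val l * word_val w.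
Proof. by rewrite /word_val big_cons. Qed.

Lemma word_val_cat v w : word_val (v ++ w) = word_val v * word_val w.
Proof. by rewrite /word_val big_cat. Qed.

Lemma word_val1 l : word_val [:: l] = letter_val l.
Proof. by rewrite word_val_cons word_val_nil mulg1. Qed.

Lemma letter_val_inv l : letter_val (letter_inv l) = (letter_val l)^-1.
Proof. by case: l => [x []|i h] //=; rewrite invgK. Qed.

Lemma word_inv_cons l w : word_inv (l :: w) = word_inv w ++ [:: letter_inv l].
Proof. by rewrite /word_inv /= rev_cons cats1. Qed.

Lemma size_word_inv w : size (word_inv w) = size w.
Proof. by rewrite /word_inv size_rev size_map. Qed.

Lemma word_val_inv w : word_val (word_inv w) = (word_val w)^-1.
Proof.
elim: w => [|l w IHw]; first by rewrite word_val_nil invg1.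
by rewrite word_inv_cons word_val_cat word_val1 IHw letter_val_inv word_val_cons invgM.
Qed.

Lemma letter_generator l : S (letter_val l) \/ S (letter_val l)^-1.
Proof.
case: l => [x b|i [h /= /andP[Hh _]]] /=; last by left; right; exists i.
by case: b; [right; rewrite invgK|left]; left; exact: set_valP.
Qed.

(** The length may be 0: the parabolic letters are nontrivial elements, so [s = 1] is spelled by the
    empty word. *)
Lemma generator_letter s : S s \/ S s^-1 ->
  exists w, word_val w = s /\ size w <= 1.
Proof.
have [->|s1] := eqVneq s 1; first by exists [::]; rewrite word_val_nil.
case=> -[Xs|[i _ His]].
- by exists [:: Gen H (exist _ s (mem_set Xs) : X) false]; rewrite word_val1.
- have Hs : (s \in H i) && (s != 1) by rewrite s1 andbT.
  by exists [:: Par X (exist _ s Hs)]; rewrite word_val1.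
- by exists [:: Gen H (exist _ s^-1 (mem_set Xs) : X) true]; rewrite word_val1 /= invgK.
- have Hs : (s \in H i) && (s != 1) by rewrite s1 andbT -(gpredV (H i)).
  by exists [:: Par X (exist _ s Hs)]; rewrite word_val1.
Qed.

Lemma spells_word w : spells S [seq letter_val l | l <- w] (word_val w).
Proof.
split; last by rewrite /word_val big_map.
by move=> _ /mapP[l _ ->]; exact: letter_generator.
Qed.

Lemma word_of_spells (t : seq G) g : spells S t g ->
  exists w, word_val w = g /\ size w <= size t.
Proof.
elim: t g => [|s t IHt] g [St <-].
  by exists [::]; rewrite word_val_nil big_nil.
have [|w [ws w1]] := @generator_letter s; first by apply: St; rewrite inE eqxx.
have [|v [vt v1]] := IHt (\prod_(r <- t) r).
  by split=> // r rt; apply: St; rewrite inE rt orbT.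
exists (w ++ v); rewrite word_val_cat ws vt big_cons size_cat /=; split=> //.
by rewrite -add1n leq_add.
Qed.

Lemma word_length_word w : word_length S (word_val w) <= size w.
Proof. by have := word_length_le (spells_word w); rewrite size_map. Qed.

Lemma geodesic_word g : generated S g ->
  exists w, word_val w = g /\ size w = word_length S g.
Proof.
case/word_lengthP => t /word_of_spells[w [<- wt]] tE; exists w; split=> //.
by apply/eqP; rewrite eqn_leq word_length_word -tE wt.
Qed.

(** A pair [g], [l] stands for the edge of the Cayley graph that leaves [g] with label [l]. This is
    the integral of a 1-cochain along the path from [g] labelled by [w]. *)
Fixpoint wsum (phi : G -> letter X H -> int) g w : int :=
  if w is l :: w' then (phi g l + wsum phi (g * letter_val l)%g w')%R else 0%R.

Lemma wsum_cat phi g v w :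
  wsum phi g (v ++ w) = (wsum phi g v + wsum phi (g * word_val v)%g w)%R.
Proof.
elim: v g => [|l v IHv] g /=; first by rewrite word_val_nil mulg1 add0r.
by rewrite IHv word_val_cons mulgA addrA.
Qed.

Lemma wsum_le phi g w (b : int) :
  (forall v1 l v2, w = v1 ++ l :: v2 -> `|phi (g * word_val v1)%g l| <= b)%R ->
  (`|wsum phi g w| <= b * (size w)%:Z)%R.
Proof.
elim: w g => [|l w IHw] g le_b /=; first by rewrite normr0 mulr0.
have := le_b [::] l w erefl; rewrite word_val_nil mulg1 => le_l.
suff /IHw : forall v1 l' v2, w = v1 ++ l' :: v2 ->
  (`|phi (g * letter_val l * word_val v1)%g l'| <= b)%R by nia.
by move=> v1 l' v2 wE; rewrite -mulgA -word_val_cons (le_b _ _ v2) //= wE.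
Qed.

Lemma wsum_word_inv phi g w :
  (forall x l, phi x (letter_inv l) = - phi (x * (letter_val l)^-1)%g l)%R ->
  wsum phi g (word_inv w) = (- wsum phi (g * word_val (word_inv w))%g w)%R.
Proof.
move=> phiN; elim: w g => [|l w IHw] g /=; first by rewrite oppr0.
rewrite word_inv_cons wsum_cat IHw /= phiN addr0 opprD addrC.
by rewrite word_val_cat word_val1 letter_val_inv !mulgA mulgVK.
Qed.

(** Closedness is asked only on the cells of the free product. The sums along the relators of [G]
    need not vanish; they are bounded separately. *)
Definition cocycle (phi : G -> letter X H -> int) : Prop :=
  forall g r s, fp_rule r s -> wsum phi g r = wsum phi g s.

Lemma wsum_fp_eq phi g v w :
  cocycle phi -> fp_eq v w -> wsum phi g v = wsum phi g w.
Proof.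
move=> phiP vw; elim: vw g => {v w} [u v r s rs|w|v w _ IH|u v w _ IH1 _ IH2] g //.
- rewrite !wsum_cat (phiP _ _ _ rs); congr (_ + (_ + wsum _ (_ * _) _))%R.
  by apply: fp_eq_val; rewrite -[r]cats0 -[s]cats0; exact: (fp_step [::] [::] rs).
- by rewrite IH1 IH2.
Qed.

(** In a factor f^-1 r f the relator r is a loop, so the two conjugating paths traverse the same
    edges in opposite directions and cancel. Only r contributes. *)
Lemma wsum_conjugates phi (B : int) (s : seq (free_product X H * seq (letter X H))) g w :
  cocycle phi ->
  (forall p, p \in s -> word_val p.2 = 1 /\ forall x, (`|wsum phi x p.2| <= B)%R) ->
  fp_class w = \prod_(p <- s) fp_class p.2 ^ p.1 ->
  (`|wsum phi g w| <= B * (size s)%:Z)%R.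
Proof.
move=> phiP; elim: s g w => [|[f r] s IHs] g w sB wE.
  have /fp_classP/(wsum_fp_eq g phiP) -> : fp_class w = fp_class [::].
    by rewrite wE big_nil.
  by rewrite /= normr0 mulr0.
have [f0 fE] := fp_class_surj f.
have [w' w'E] := fp_class_surj (\prod_(p <- s) fp_class p.2 ^ p.1).
have /= [r1 rB] := sB _ (mem_head _ _).
have /fp_classP/(wsum_fp_eq g phiP) -> :
    fp_class w = fp_class ((word_inv f0 ++ r ++ f0) ++ w').
  by rewrite wE big_cons w'E /= fE !fp_class_cat fp_class_inv.
have sB' p : p \in s -> word_val p.2 = 1 /\ forall x, (`|wsum phi x p.2| <= B)%R.
  by move=> ps; apply: sB; rewrite inE ps orbT.
have := IHs (g * word_val (word_inv f0 ++ r ++ f0)) w' sB' (esym w'E).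
have /(wsum_fp_eq g phiP) := fp_invl f0.
have := rB (g * word_val (word_inv f0)).
by rewrite !wsum_cat /= r1 mulg1 -/(size s); nia.
Qed.

End Words.

(** * Cochains given by a function on ordinary edges and potentials on parabolic cosets *)

Section EdgeCochains.
Local Open Scope classical_set_scope.
Local Open Scope group_scope.
Context {G : groupType} (X : set G) {m : nat} (H : 'I_m -> groupClosed G).
Implicit Types (w : seq (letter X H)) (l : letter X H) (g x y : G).

Lemma wsumB phi psi g w :
  wsum (fun x l => phi x l - psi x l)%R g w = (wsum phi g w - wsum psi g w)%R.
Proof. by elim: w g => [|l w IHw] g /=; rewrite ?subr0 // IHw opprD addrACA. Qed.

Definition edge_cochain (a : G -> G -> int) (P : 'I_m -> G -> int) g l : int :=
  match l with
  | Gen _ _ => a g (g * letter_val l)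
  | Par i h => (P i (g * val h)%g - P i g)%R
  end.

(* A potential on each parabolic coset telescopes along the relations of that
   factor, so it may be unrelated to the values taken on the other edges. *)
Lemma edge_cochain_cocycle a P :
  (forall x y, a y x = - a x y)%R -> cocycle (edge_cochain a P).
Proof.
move=> aN g _ _ [x b|i h k l e|i h k e] /=.
- have := letter_val_inv (Gen H x b); rewrite /= => ->.
  by rewrite mulgK [a (g * _) g]aN addr0 subrr.
- by rewrite -e mulgA !addr0 addrC addrA subrK.
- by rewrite -mulgA e mulg1 addr0 addrA subrK subrr.
Qed.

Definition coset_rep i y : G := choose [pred z | y^-1 * z \in H i] y.

Lemma coset_repP i y : y^-1 * coset_rep i y \in H i.
Proof. by apply: (@chooseP _ [pred z | y^-1 * z \in H i]); rewrite /= mulVg gpred1. Qed.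

(** The value of [choose] depends on the predicate only, as long as the default satisfies it. Here
    the predicate is the coset, and both defaults lie in it. *)
Lemma coset_repM i y h : h \in H i -> coset_rep i (y * h) = coset_rep i y.
Proof.
move=> Hh; rewrite /coset_rep.
have e : [pred z | (y * h)^-1 * z \in H i] =1 [pred z | y^-1 * z \in H i].
  by move=> z /=; rewrite invgM -mulgA gpredMl // gpredV.
by rewrite (eq_choose e); apply: choose_id; rewrite /= ?mulVg ?gpred1 // mulKg.
Qed.

End EdgeCochains.

(** * The area form of two Lipschitz functions *)

Section Area.
Local Open Scope classical_set_scope.
Local Open Scope group_scope.
Context {G : groupType} (len : G -> nat).
Implicit Types (f h : G -> int) (g x y : G).

Definition lipschitz f : Prop := forall x y, (`|f (x * y)%g - f x| <= (len y)%:Z)%R.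

(** Twice the trapezoid rule for the integral of h df; the factor 2 keeps the values integral.
    Around a loop it gives, up to sign, twice the area enclosed by the image of the loop in the
    plane under (f, h). *)
Definition area f h x y : int := ((h x + h y) * (f y - f x))%R.

Lemma area_antisym f h x y : (area f h y x = - area f h x y)%R.
Proof. by rewrite /area; lia. Qed.

Context (X : set G) {m : nat} (H : 'I_m -> groupClosed G).
Implicit Types (w : seq (letter X H)) (l : letter X H).

Definition area_sum f h g w : int :=
  wsum (fun x l => area f h x (x * letter_val l)) g w.

Definition cost w : nat := \sum_(l <- w) len (letter_val l).

Lemma lipschitz_word f g w :
  lipschitz f -> (`|f (g * word_val w)%g - f g| <= (cost w)%:Z)%R.
Proof.
rewrite /cost => fL; elim: w g => [|l w IHw] g.
  by rewrite word_val_nil mulg1 subrr big_nil.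
have := IHw (g * letter_val l); have := fL g (letter_val l).
rewrite -mulgA -word_val_cons big_cons; set a := (\sum_(_ <- _) _)%N.
move: (f (g * word_val _)%g) (f (g * letter_val l)%g) (f g) a (len _) => *; lia.
Qed.

Lemma int_norm_mul_le (a b : int) (A B : nat) :
  (`|a| <= A%:Z -> `|b| <= B%:Z -> `|a * b| <= (A * B)%N%:Z)%R.
Proof. by move=> aA bB; rewrite normrM PoszM ler_pM. Qed.

(** Let an edge lead from accumulated cost s to s'. On it h x + h y differs from 2 h g by at most s
    + s', and f changes by at most s' - s. The error is at most s'^2 - s^2, and these bounds
    telescope. *)
Lemma area_sum_approx f h g w : lipschitz f -> lipschitz h ->
  (`|area_sum f h g w - 2 * h g * (f (g * word_val w)%g - f g)| <=
    (cost w ^ 2)%N%:Z)%R.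
Proof.
move=> fL hL; elim: w g => [|l w IHw] g.
  by rewrite /area_sum /= word_val_nil mulg1 subrr mulr0 subr0 normr0.
have := IHw (g * letter_val l); have := lipschitz_word (g * letter_val l) w fL.
have f1 := fL g (letter_val l); have h1 := hL g (letter_val l).
have := int_norm_mul_le h1 f1.
have := int_norm_mul_le h1 (lipschitz_word (g * letter_val l) w fL).
rewrite /area_sum /= /area -mulgA -word_val_cons.
have -> : cost (l :: w) = len (letter_val l) + cost w by rewrite /cost big_cons.
rewrite -!mulnn; move: (wsum _ _ _) (f (g * word_val _)%g) (f (g * letter_val l)%g) (f g).
move: (h g) (h (g * letter_val l)%g) (cost w) (len _) => *; nia.
Qed.

Lemma area_sum_loop f h g w : lipschitz f -> lipschitz h -> word_val w = 1 ->
  (`|area_sum f h g w| <= (cost w ^ 2)%N%:Z)%R.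
Proof.
by move=> fL hL w1; have := area_sum_approx g w fL hL; rewrite w1 mulg1 subrr mulr0 subr0.
Qed.

Hypothesis len_par : forall i y, y \in H i -> len y <= 1.

(* The detour of an [H i]-edge through a representative of its coset makes the
   area form vanish on closed paths inside that coset. *)
Definition coned_area f h : G -> letter X H -> int :=
  edge_cochain (area f h) (fun i y => area f h (coset_rep H i y) y).

(** The two cochains differ only on parabolic edges, by the area form around the triangle formed by
    the two ends and the coset representative. This is a 2 by 2 determinant with entries of absolute
    value at most 1. *)
Lemma coned_area_approx f h g w : lipschitz f -> lipschitz h ->
  (`|wsum (coned_area f h) g w - area_sum f h g w| <= 2 * (size w)%:Z)%R.
Proof.
move=> fL hL; rewrite -wsumB; apply: wsum_le => v l _ _.
case: l => [x b|i [y yP]] /=; first by rewrite subrr.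
have /andP[Hy _] := yP.
set x := g * word_val v; rewrite coset_repM // /coned_area.
have xr := coset_repP H i x; set r := coset_rep H i x in xr *.
have rL k : lipschitz k -> (`|k r - k x| <= 1)%R.
  move=> kL; have := kL x (x^-1 * r); have := len_par xr; rewrite mulVKg; lia.
have ryL k : lipschitz k -> (`|k (x * y)%g - k r| <= 1)%R.
  move=> kL; have := kL r (r^-1 * (x * y)); rewrite mulVKg.
  suff /len_par : r^-1 * (x * y) \in H i by lia.
  by rewrite mulgA gpredMr // -gpredV invgM invgK.
have xyL k : lipschitz k -> (`|k (x * y)%g - k x| <= 1)%R.
  by move=> kL; have := kL x y; have := len_par Hy; lia.
have := int_norm_mul_le (ryL h hL) (rL f fL).
have := int_norm_mul_le (rL h hL) (ryL f fL).
by rewrite /area; lia.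
Qed.

End Area.

(** * Linear isoperimetric inequalities for cochains *)

Section Isoperimetry.
Local Open Scope classical_set_scope.
Local Open Scope group_scope.
Context {K : realType} {G : groupType} {m : nat} (H : 'I_m -> groupClosed G).

(** The linear Dehn function writes [w] as a product of at most [L * size w] conjugates of relators,
    and each contributes at most [B]. *)
Lemma linear_isoperimetry : relatively_hyperbolic K H ->
  exists (X : set G) (Rel : set (seq (letter X H))) (L : nat),
  [/\ finite_set Rel, generated (relative_generators H X) = setT,
      forall r, Rel r -> word_val r = 1 &
      forall phi (B : nat), cocycle phi ->
        (forall g r, Rel r -> (`|wsum phi g r| <= B%:Z)%R) ->
      forall g w, word_val w = 1 ->
        (`|wsum phi g w| <= (B * L * size w)%N%:Z)%R].
Proof.
case=> X [Rel [finX genX [finR _ ncR] [f [L [[fP _] fL]]]]].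
have Rel1 r : Rel r -> word_val r = 1.
  move=> Rr; have : normal_closure (@fp_class G X m H @` Rel) (fp_class r).
    by move=> N _ /(_ (fp_class r)); apply; exists r.
  by rewrite ncR /= fp_val_class.
have [n Ln] := nat_upper_bound L.
exists X, Rel, n; split=> // phi B phiP phiB g w w1.
have [s [sR wE sf]] := fP _ _ (leqnn (size w)) w1.
have f_le : f (size w) <= n * size w.
  rewrite -(ler_nat K) natrM; apply: le_trans (fL _) _.
  by rewrite ler_wpM2r ?ler0n.
have /(wsum_conjugates g phiP) : forall p, p \in s ->
    word_val p.2 = 1 /\ forall x, (`|wsum phi x p.2| <= B%:Z)%R.
  by move=> p /sR Rp; split=> [|x]; [exact: Rel1|exact: phiB].
move=> /(_ w wE) /le_trans; apply; rewrite -PoszM lez_nat -mulnA leq_mul2l.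
by rewrite (leq_trans sf f_le) orbT.
Qed.

Lemma generator_word (X : set G) : generated (relative_generators H X) = setT ->
  forall g, exists w : seq (letter X H), word_val w = g.
Proof.
move=> genX g; have /geodesic_word[w [wg _]] : generated (relative_generators H X) g.
  by rewrite genX.
by exists w.
Qed.

(** The presentation comes with its own generating set [X'], so the letters of [X] are translated by
    [tau] and the parabolic ones are kept. The finite set [Rel] is enlarged by these translations so
    that one bound controls both; the added words need not be loops. *)
Lemma isoperimetry_change_generators (X : set G) :
  finite_set X -> relatively_hyperbolic K H ->
  exists (X' : set G) (Rel : set (seq (letter X' H))) (L : nat)
    (tau : letter X H -> seq (letter X' H)),
  [/\ finite_set Rel, forall l, word_val (tau l) = letter_val l,
      forall i h, tau (Par X h) = [:: Par (i := i) X' h],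
      forall x b, Rel (tau (Gen H x b)) &
      forall phi (B : nat), cocycle phi ->
        (forall g r, Rel r -> word_val r = 1 -> (`|wsum phi g r| <= B%:Z)%R) ->
      forall g w, word_val w = 1 ->
        (`|wsum (fun x l => wsum phi x (tau l)) g w| <= (B * L * size w)%N%:Z)%R].
Proof.
move=> finX /linear_isoperimetry[X' [Rel [L [finR genX' R1 iso]]]].
have [t tP] := choice (generator_word genX').
pose tau (l : letter X H) := if l is Par i h then [:: Par X' h] else t (letter_val l).
have tauP l : word_val (tau l) = letter_val l.
  by case: l => [x b|i h]; rewrite /tau ?tP // word_val1.
pose Rel' := Rel `|` t @` (X `|` [set x^-1 | x in X]).
have finR' : finite_set Rel'.
  by rewrite finite_setU; split=> //; apply: finite_image; rewrite finite_setU;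
     split=> //; exact: finite_image.
have R'tau x b : Rel' (tau (Gen H x b)).
  right; exists (letter_val (Gen H x b)) => //=; case: b; last by left; exact: set_valP.
  by right; exists (val x) => //; exact: set_valP.
have [k kP] := finite_set_bounded size finR'.
(* The successor covers the parabolic letters, whose translation has length 1 even if [k] is 0. *)
exists X', Rel', (L * k.+1)%N, tau; split=> // phi B phiP phiB g w w1.
have wE : wsum (fun x l => wsum phi x (tau l)) g w = wsum phi g (flatten (map tau w)).
  elim: w g {w1} => [|l w IHw] g //=.
  by rewrite wsum_cat tauP IHw.
have val_w : word_val (flatten (map tau w)) = 1.
  rewrite -w1; elim: w {w1 wE} => [|l w IHw] /=; first by rewrite !word_val_nil.
  by rewrite word_val_cat tauP IHw word_val_cons.
have size_w : size (flatten (map tau w)) <= k.+1 * size w.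
  elim: w {w1 wE val_w} => [|l w IHw] //=; rewrite size_cat mulnS leq_add //.
  by case: l => [x b|i h] //; exact/leqW/kP/R'tau.
rewrite wE; apply: le_trans (iso _ B phiP _ _ _ val_w) _.
  by move=> x r Rr; apply: phiB; [left|exact: R1].
by rewrite lez_nat mulnA -[X in _ <= X]mulnA leq_mul.
Qed.

Context (X : set G).
Hypothesis (finX : finite_set X) (hypG : relatively_hyperbolic K H).
Notation S := (relative_generators H X).
Notation len := (word_length S).
Implicit Types (w : seq (letter X H)) (g : G).

Lemma parabolic_length i y : y \in H i -> len y <= 1.
Proof.
have [->|y1] := eqVneq y 1; first by rewrite word_length1.
move=> Hy; apply: (@word_length_le _ S [:: y]); apply: spells1; left; right.
by exists i.
Qed.

Lemma letter_length (l : letter X H) : len (letter_val l) <= 1.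
Proof. by have := word_length_word [:: l]; rewrite word_val1. Qed.

Lemma area_isoperimetry : exists C : nat, forall f h,
  lipschitz len f -> lipschitz len h -> forall g w, word_val w = 1 ->
  (`|area_sum f h g w| <= (C * size w)%N%:Z)%R.
Proof.
have [X' [Rel [L [tau [finR tauP tauPar tauGen iso]]]]] :=
  isoperimetry_change_generators finX hypG.
pose q (r : seq (letter X' H)) := (cost len r ^ 2 + 2 * size r)%N.
have [k kP] := finite_set_bounded q finR.
(* The term [k * L] bounds the coned area of the translated loop; [k + 2] bounds, for one letter,
   the difference between the coned area of its translation and the area of its edge. *)
exists (k * L + k + 2)%N => f h fL hL g w w1.
pose phi := @coned_area G X' m H f h.
have phiP : cocycle phi by apply: edge_cochain_cocycle => x y; exact: area_antisym.
have := iso phi k phiP _ g w w1 => isow.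
have {}isow : (`|wsum (fun x l => wsum phi x (tau l)) g w| <= (k * L * size w)%N%:Z)%R.
  apply: isow => x r Rr r1.
  have := coned_area_approx parabolic_length x r fL hL.
  have := area_sum_loop x fL hL r1; have := kP r Rr; rewrite /q -/phi.
  move: (wsum _ _ _) (area_sum _ _ _ _) (cost _ _ ^ 2)%N (size r) => *; lia.
suff diff : (`|wsum (fun x l => wsum phi x (tau l)) g w - area_sum f h g w| <=
    (k + 2)%N%:Z * (size w)%:Z)%R.
  move: isow diff; move: (wsum _ _ _) (area_sum _ _ _ _) (size w) => *; nia.
rewrite -wsumB; apply: wsum_le => v l _ _; move: (g * _) => x.
have := coned_area_approx parabolic_length x (tau l) fL hL.
case: l => [y b|i y].
  have := kP _ (tauGen y b); rewrite /q -/phi.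
  have := area_sum_approx x (tau (Gen H y b)) fL hL; rewrite tauP.
  have := int_norm_mul_le (hL x (letter_val (Gen H y b))) (fL x (letter_val (Gen H y b))).
  have := letter_length (Gen H y b); rewrite /area.
  set l := letter_val _; move: (area_sum _ _ _ _) (wsum _ _ _) (cost _ _ ^ 2)%N (size _).
  move: (h x) (h (x * l)%g) (f x) (f (x * l)%g) (len l) => *; nia.
rewrite tauPar /area_sum /= !addr0 => /le_trans; apply; lia.
Qed.

Definition coset_sum i (P : G -> int) g w : int :=
  wsum (edge_cochain (fun _ _ => 0%R) (fun j y => if j == i then P y else 0%R)) g w.

(** [Omega] collects the values of the letters in the finitely many words of [Rel]. Then [P] changes
    by at most 1 along each of their letters in [H i], so the sum over such a word is at most its
    length. *)
Lemma coset_isoperimetry : exists (Omega : set G) (C : nat), finite_set Omega /\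
  forall i P, (forall y s, Omega s -> s \in H i -> (`|P (y * s)%g - P y| <= 1)%R) ->
  forall g w, word_val w = 1 -> (`|coset_sum i P g w| <= (C * size w)%N%:Z)%R.
Proof.
have [X' [Rel [L [tau [finR tauP tauPar tauGen iso]]]]] :=
  isoperimetry_change_generators finX hypG.
pose Omega := \bigcup_(r in Rel) [set letter_val l | l in [set` r]].
have [k kP] := finite_set_bounded size finR.
exists Omega, (k * L + k)%N; split.
  apply: bigcup_finite => // r _; apply: finite_image; exact: finite_seq.
move=> i P PL g w w1.
pose phi := @edge_cochain G X' m H (fun _ _ => 0%R)
  (fun j y => if j == i then P y else 0%R).
have phiP : cocycle phi by apply: edge_cochain_cocycle => x y; rewrite oppr0.
have phiR x r : Rel r -> (`|wsum phi x r| <= (size r)%:Z)%R.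
  move=> Rr; rewrite -[X in (_ <= X)%R]mul1r; apply: wsum_le => v l v2 rE.
  case: l rE => [y b|j y] rE /=; first by rewrite normr0.
  case: eqVneq => [ji|_]; last by rewrite subrr normr0.
  apply: PL; last by rewrite -ji; have /andP[] := valP y.
  by exists r => //; exists (Par X' y) => //=; rewrite rE mem_cat mem_head orbT.
have := iso phi k phiP _ g w w1 => isow.
have {}isow : (`|wsum (fun x l => wsum phi x (tau l)) g w| <= (k * L * size w)%N%:Z)%R.
  by apply: isow => x r Rr _; apply: le_trans (phiR x r Rr) _; rewrite lez_nat kP.
suff diff : (`|wsum (fun x l => wsum phi x (tau l)) g w - coset_sum i P g w| <=
    k%:Z * (size w)%:Z)%R.
  move: isow diff; move: (wsum _ _ _) (coset_sum _ _ _ _) (size w) => *; nia.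
rewrite -wsumB; apply: wsum_le => v l _ _; move: (g * _) => x.
case: l => [y b|j y]; last by rewrite tauPar /= addr0 subrr.
rewrite /= subr0; apply: le_trans (phiR _ _ _) _; first exact: tauGen.
by rewrite lez_nat; exact/kP/tauGen.
Qed.

End Isoperimetry.

(** * Geodesics and the distance to a subgroup *)

Section LengthFunction.
Local Open Scope classical_set_scope.
Local Open Scope group_scope.
Context {G : groupType} (X : set G) {m : nat} (H : 'I_m -> groupClosed G).
Hypothesis genS : generated (relative_generators H X) = setT.
Notation len := (word_length (relative_generators H X)).
Implicit Types (u v w : seq (letter X H)) (g x y z : G).

Lemma lenM x y : len (x * y) <= len x + len y.
Proof. by apply: word_lengthM; rewrite genS. Qed.

Lemma lenV x : len x^-1 = len x.
Proof. by apply: word_lengthV; rewrite genS. Qed.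

Lemma lenC x y : len (x^-1 * y) = len (y^-1 * x).
Proof. by rewrite -lenV invgM invgK. Qed.

Lemma len_geodesic g : exists w, word_val w = g /\ size w = len g.
Proof. by apply: geodesic_word; rewrite genS. Qed.

Definition geodesic w : Prop := size w = len (word_val w).

Lemma geodesic_catl v w : geodesic (v ++ w) -> geodesic v.
Proof.
rewrite /geodesic size_cat word_val_cat => e.
have := lenM (word_val v) (word_val w).
by have := word_length_word v; have := word_length_word w; lia.
Qed.

Lemma geodesic_catr v w : geodesic (v ++ w) -> geodesic w.
Proof.
rewrite /geodesic size_cat word_val_cat => e.
have := lenM (word_val v) (word_val w).
by have := word_length_word v; have := word_length_word w; lia.
Qed.

(** Otherwise the stretch from [h] to [k], of length at least 2, would represent an element of [H i]
    and could be replaced by at most one edge. *)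
Lemma geodesic_no_backtracking u v w i h k :
  geodesic (u ++ Par (i := i) X h :: v ++ Par (i := i) X k :: w) ->
  word_val v \notin H i.
Proof.
move=> /geodesic_catr; rewrite -cat1s -[_ :: w]cat1s !catA => /geodesic_catl geo.
apply/negP => Hv; move: geo; rewrite /geodesic !size_cat !word_val_cat !word_val1 /=.
have [/andP[Hh _] /andP[Hk _]] := (valP h, valP k).
have : val h * word_val v * val k \in H i by rewrite gpredM // gpredM.
by move=> /(parabolic_length X); rewrite -?mulgA; move: (len _) => n; lia.
Qed.

Lemma lipschitz_len : lipschitz len (fun x => Posz (len x)).
Proof.
move=> x y; have := lenM x y; have := lenM (x * y) y^-1; rewrite mulgK lenV.
by move: (len _) (len _) (len _) => *; lia.
Qed.

(** By truncated subtraction this is a tent of height [E] centred at [z], zero at distance [E] and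
    beyond. *)
Lemma lipschitz_bump z (E : nat) : lipschitz len (fun x => Posz (E - len (z^-1 * x))).
Proof.
move=> x y; have := lipschitz_len (z^-1 * x) y; rewrite mulgA.
by move: (len _) (len _) (len _) => *; lia.
Qed.

Section DistanceToSubgroup.
Context (R : groupClosed G).

Fact subgroup_distance_subproof g :
  exists n, `[< exists2 y, y \in R & len (g^-1 * y) = n >].
Proof. by exists (len (g^-1 * 1)); apply/asboolP; exists 1; rewrite ?gpred1. Qed.

Definition subgroup_distance g : nat := ex_minn (subgroup_distance_subproof g).
Notation dist := subgroup_distance.

Lemma subgroup_distance_le g y : y \in R -> dist g <= len (g^-1 * y).
Proof.
move=> Ry; rewrite /dist; case: ex_minnP => n _; apply.
by apply/asboolP; exists y.
Qed.

Lemma connecting_word g :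
  exists w, [/\ g * word_val w \in R, geodesic w & size w = dist g].
Proof.
rewrite /dist; case: ex_minnP => n /asboolP[y Ry <-] _.
have [w [wE sw]] := len_geodesic (g^-1 * y).
by exists w; rewrite /geodesic wE mulVKg.
Qed.

Lemma subgroup_distance_lipschitz g x : dist g <= len (g^-1 * x) + dist x.
Proof.
have [w [Rw _ <-]] := connecting_word x.
apply: leq_trans (subgroup_distance_le _ Rw) _; rewrite mulgA.
by apply: leq_trans (lenM _ _) _; rewrite leq_add2l word_length_word.
Qed.

Lemma subgroup_distance_eq0 g : g \in R -> dist g = 0.
Proof. by move/(subgroup_distance_le g); rewrite mulVg word_length1 leqn0 => /eqP. Qed.

Lemma subgroup_distance_translate r g : r \in R -> dist (r * g) <= dist g.
Proof.
have [w [Rw geo <-]] := connecting_word g => Rr.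
have := @subgroup_distance_le (r * g) (r * (g * word_val w)).
rewrite gpredM // => /(_ isT) /leq_trans; apply.
by rewrite invgM !mulgA mulgVK mulVg mul1g word_length_word.
Qed.

(** Either [x] is at distance at least 2D from [z] and a path of length at most D cannot come closer
    than D, or [x] is in [R], the path is trivial and [x] is at distance at least [dist z] from
    [z]. *)
Lemma connecting_word_far z x D w w1 w2 :
  D <= len (z^-1 * x) - D \/ x \in R -> dist z = D -> dist x <= D ->
  size w = dist x -> w = w1 ++ w2 -> D <= len (z^-1 * (x * word_val w1)).
Proof.
move=> far zD xD sw wE; have := word_length_word w1.
have : size w1 <= size w by rewrite wE size_cat leq_addr.
case: far => [far|Rx].
  have := lenM (z^-1 * (x * word_val w1)) (word_val w1)^-1.
  rewrite lenV !mulgA mulgK; move: far xD sw.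
  by move: (len _) (len _) (len _) (size _) (size _) => *; lia.
rewrite sw subgroup_distance_eq0 // leqn0 size_eq0 => /eqP -> _.
by rewrite word_val_nil mulg1 -zD subgroup_distance_le.
Qed.

End DistanceToSubgroup.

Implicit Types (f h : G -> int).

Lemma area_sum_cat f h g v w :
  area_sum f h g (v ++ w) = (area_sum f h g v + area_sum f h (g * word_val v)%g w)%R.
Proof. exact: wsum_cat. Qed.

Lemma area_sum_eq0 f h g w :
  (forall w1 w2, w = w1 ++ w2 -> h (g * word_val w1) = 0%R) -> area_sum f h g w = 0%R.
Proof.
move=> h0; suff : (`|area_sum f h g w| <= 0 * (size w)%:Z)%R by lia.
apply: wsum_le => v1 l v2 wE; rewrite /area (h0 v1 _ wE) -mulgA -word_val1 -word_val_cat.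
by rewrite (h0 _ v2) ?addr0 ?mul0r // -catA.
Qed.

Lemma area_sum_inv f h g w :
  area_sum f h g (word_inv w) = (- area_sum f h (g * word_val (word_inv w))%g w)%R.
Proof.
apply: wsum_word_inv => x l.
by rewrite letter_val_inv mulgVK area_antisym.
Qed.

Lemma area_sum_ge0 f h g w :
  (forall w1 w2, w = w1 ++ w2 -> f (g * word_val w1)%g = f g + (size w1)%:Z)%R ->
  (forall x, 0 <= h x)%R -> (0 <= area_sum f h g w)%R.
Proof.
move=> fE h0; elim: w g fE => [|l w IHw] g fE //=.
rewrite /area_sum /= addr_ge0 //.
  have /= := fE [:: l] w erefl; rewrite word_val1 /area => ->.
  by move: (h0 g) (h0 (g * letter_val l)%g); move: (h _) (h _) (f g) => *; nia.
apply: IHw => w1 w2 wE; have /= := fE (l :: w1) w2.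
rewrite wE word_val_cons mulgA => -> //.
by have /= := fE [:: l] w erefl; rewrite word_val1 => ->; lia.
Qed.

(** An edge followed by k further edges contributes at least (k + 1) + k, and the first n odd
    numbers add up to n^2. *)
Lemma area_sum_sqr f h g w :
  (forall w1 w2, w = w1 ++ w2 -> f (g * word_val w1)%g = f g + (size w1)%:Z)%R ->
  (forall w1 w2, w = w1 ++ w2 -> (size w2)%:Z <= h (g * word_val w1)%g)%R ->
  ((size w)%:Z * (size w)%:Z <= area_sum f h g w)%R.
Proof.
elim: w g => [|l w IHw] g fE hE //=.
have /IHw IH : forall w1 w2, w = w1 ++ w2 ->
    (f (g * letter_val l * word_val w1)%g = f (g * letter_val l)%g + (size w1)%:Z)%R.
  move=> w1 w2 wE; rewrite -mulgA -word_val_cons (fE _ w2) /= ?wE //.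
  by have /= := fE [:: l] w erefl; rewrite word_val1 => ->; lia.
have {}IH : ((size w)%:Z * (size w)%:Z <= area_sum f h (g * letter_val l)%g w)%R.
  by apply: IH => w1 w2 wE; rewrite -mulgA -word_val_cons hE //= wE.
have /= := fE [:: l] w erefl; have /= := hE [:: l] w erefl; have /= := hE [::] _ erefl.
rewrite word_val1 word_val_nil mulg1 /area_sum /= /area => h0 h1 ->.
move: IH; rewrite /area_sum /area.
by move: (wsum _ _ _) (h _) (h g) (f g) (size w) h0 h1 => *; nia.
Qed.

End LengthFunction.

(** * Sums over the parabolic edges of one type *)

Section CosetSums.
Local Open Scope classical_set_scope.
Local Open Scope group_scope.
Context {G : groupType} {X : set G} {m : nat} {H : 'I_m -> groupClosed G}.
Implicit Types (u v w : seq (letter X H)) (P : G -> int) (g x y z : G).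

Lemma coset_sum_cat i P g v w :
  coset_sum i P g (v ++ w) = (coset_sum i P g v + coset_sum i P (g * word_val v)%g w)%R.
Proof. exact: wsum_cat. Qed.

Lemma coset_sum_inv i P g w :
  coset_sum i P g (word_inv w) = (- coset_sum i P (g * word_val (word_inv w))%g w)%R.
Proof.
apply: wsum_word_inv => x [y b|j y] /=; first by rewrite oppr0.
by rewrite mulgVK opprB.
Qed.

Lemma coset_sum_le i P g w (B : nat) :
  (forall w1 k w2, w = w1 ++ Par (i := i) X k :: w2 ->
     (`|P (g * word_val w1 * val k)%g - P (g * word_val w1)%g| <= B%:Z)%R) ->
  (`|coset_sum i P g w| <= (B * size w)%N%:Z)%R.
Proof.
move=> PB; rewrite PoszM; apply: wsum_le => w1 [y b|j k] w2 wE /=.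
  by rewrite normr0.
case: eqVneq => [ji|_]; last by rewrite subrr normr0.
by subst j; exact: PB wE.
Qed.

(** An [H i]-edge stays in one left coset, and [P] is constant outside the coset [H i] itself, which
    no such edge of [w] meets. *)
Lemma coset_sum_isolated i P g w :
  (forall y z, y \notin H i -> z \notin H i -> P y = P z) ->
  (forall w1 k w2, w = w1 ++ Par (i := i) X k :: w2 -> g * word_val w1 \notin H i) ->
  coset_sum i P g w = 0%R.
Proof.
move=> Pout iso; suff : (`|coset_sum i P g w| <= (0 * size w)%N%:Z)%R by lia.
apply: coset_sum_le => w1 k w2 wE; have out := iso _ _ _ wE.
have /andP[Hk _] := valP k.
by rewrite (Pout _ _ _ out) ?subrr ?normr0 // gpredMr.
Qed.

(** Unlike a bound on [word_length], which has a dummy value, this includes that [g] is generated by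
    [A]. *)
Definition in_ball (A : set G) (n : nat) g : Prop :=
  exists2 w, spells A w g & size w <= n.

Lemma in_ball_lipschitz A n g P :
  (forall y s, A s -> (`|P (y * s)%g - P y| <= 1)%R) -> in_ball A n g ->
  forall y, (`|P (y * g)%g - P y| <= n%:Z)%R.
Proof.
move=> PA [w [Aw <-] wn] y; suff : (`|P (y * \prod_(s <- w) s)%g - P y| <= (size w)%:Z)%R.
  by move/le_trans; apply; rewrite lez_nat.
elim: w Aw y {wn} => [|s w IHw] Aw y; first by rewrite big_nil mulg1 subrr.
have /IHw/(_ (y * s)) : word_over A w by move=> t tw; apply: Aw; rewrite inE tw orbT.
have : (`|P (y * s)%g - P y| <= 1)%R.
  case: (Aw s (mem_head _ _)) => As; first exact: PA.
  by have := PA (y * s) _ As; rewrite mulgK distrC.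
rewrite big_cons mulgA /=; move: (P _) (P _) (P _) (size w) => *; lia.
Qed.

End CosetSums.

(** * Parabolic edges that are almost alone in their coset on a loop *)

Section IsolatedComponents.
Local Open Scope classical_set_scope.
Local Open Scope group_scope.
Context {K : realType} {G : groupType} (X : set G) {m : nat} (H : 'I_m -> groupClosed G).
Hypothesis (finX : finite_set X) (hypG : relatively_hyperbolic K H).
Implicit Types (w : seq (letter X H)).

Definition coset_potential (A : set G) i (P : G -> int) : Prop :=
  (forall y s, A s -> (`|P (y * s)%g - P y| <= 1)%R) /\
  (forall y z, y \notin H i -> z \notin H i -> P y = P z).

(** Take as potential the truncated word length over [Omega] in [H i]. It rises by the length of [h]
    along the first edge; the rest of the loop compensates at most [b] of this, and the
    isoperimetric inequality bounds the total. *)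
Lemma isolated_component : exists (Omega : set G) (C : nat), finite_set Omega /\
  forall i (h : {h : G | (h \in H i) && (h != 1)}) w (b : nat),
  val h * word_val w = 1 ->
  (forall P, coset_potential (Omega `&` [set` H i]) i P ->
    (`|coset_sum i P (val h) w| <= b%:Z)%R) ->
  in_ball (Omega `&` [set` H i]) (C * (size w).+1 + b)%N (val h).
Proof.
have [Omega [C [finO iso]]] := coset_isoperimetry finX hypG.
exists Omega, C; split=> // i h w b loop le_b.
set A := Omega `&` _ in le_b *; set N := (_ + b)%N.
(* The cap [N.+1] lets the potential be extended by a constant outside the subgroup generated by
   [A]. Once [P (val h) <= N] is known, the cap is not reached at [h]. *)
pose P y := Posz (if pselect (generated A y) is left _
                  then minn N.+1 (word_length A y) else N.+1).
have AH y : generated A y -> y \in H i by apply: generated_sub_group => s [].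
have genA y s : A s -> generated A (y * s) -> generated A y.
  move=> As Ays; rewrite -[y](mulgK s); apply: generatedM => //.
  by apply: generatedV; exists [:: s]; apply: spells1; left.
have genA1 s : A s -> generated A s /\ word_length A s <= 1.
  move=> As; have sA : spells A [:: s] s by apply: spells1; left.
  by split; [exists [:: s]|exact: word_length_le sA].
have P_lip y s : A s -> (`|P (y * s)%g - P y| <= 1)%R.
  move=> As; have [gs s1] := genA1 s As; rewrite /P.
  case: pselect => [gys|ngys]; case: pselect => [gy|ngy] //.
  - have := word_lengthM gy gs; have := word_lengthM gys (generatedV gs).
    rewrite mulgK word_lengthV //; move: s1.
    by move: (word_length _ _) (word_length _ _) (word_length _ _) => *; lia.
  - by have := genA _ _ As gys.
  - by case: ngys; exact: generatedM.
  - by rewrite subrr.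
have P_out y z : y \notin H i -> z \notin H i -> P y = P z.
  move=> Hy Hz; rewrite /P; case: pselect => [/AH yH|_]; first by rewrite yH in Hy.
  by case: pselect => [/AH zH|//]; rewrite zH in Hz.
have P1 : P 1 = 0%R.
  rewrite /P; case: pselect => [_|[]]; last exact: generated1.
  by rewrite word_length1 minn0.
(* The loop is based at 1, so that the edge of [h] lies in the coset [H i], where the potential
   varies. *)
have := iso i P (fun y s Os Hs => P_lip y s (conj Os Hs)) 1 (Par X h :: w).
rewrite word_val_cons => /(_ loop); rewrite {1}/coset_sum /= eqxx.
rewrite mul1g P1 subr0 -/(coset_sum i P (val h) w).
have := le_b P (conj P_lip P_out).
move=> hb hC; have : (P (val h) <= N%:Z)%R.
  move: hb hC; rewrite /N; move: (P _) (coset_sum _ _ _ _) => *; lia.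
rewrite /P; case: pselect => [gh|_]; last lia.
have [v vh vs] := word_lengthP gh => le_N; exists v => //.
by rewrite vs; move: le_N; lia.
Qed.

End IsolatedComponents.

(** * Geodesics with ends in a quasi-isometrically embedded subgroup *)

Section QuasiIsometricSubgroup.
Local Open Scope classical_set_scope.
Local Open Scope group_scope.
Context {K : realType} {G : groupType} (X : set G) {m : nat} (H : 'I_m -> groupClosed G).
Hypothesis (finX : finite_set X) (hypG : relatively_hyperbolic K H).
Hypothesis genS : generated (relative_generators H X) = setT.
Context (R : groupClosed G) (c : nat).
Notation len := (word_length (relative_generators H X)).
Notation dist := (subgroup_distance X H R).
Implicit Types (u v w q s : seq (letter X H)) (g x y z : G).

Definition parabolic_free w : Prop := forall i h, Par (i := i) X h \notin w.

(** This is what the quasi-isometric embedding provides: paths over [X] between points of [R] that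
    are linearly short in the relative metric and stay near [R]. *)
Hypothesis subgroup_word : forall r, r \in R -> exists q,
  [/\ word_val q = r, size q <= c * (len r).+1, parabolic_free q &
      forall q1 q2, q = q1 ++ q2 -> dist (word_val q1) <= c].

(** The ends of [s] and [t] in [R] are joined by a translate of a path from [subgroup_word]; their
    relative distance is at most the total length of the three given sides. *)
Lemma subgroup_polygon x y w s t :
  x * word_val w = y -> x * word_val s \in R -> y * word_val t \in R ->
  exists q, [/\ word_val (w ++ t ++ q ++ word_inv s) = 1,
    size q <= c * (size w + size s + size t).+1, parabolic_free q &
    forall q1 q2, q = q1 ++ q2 -> dist (y * word_val t * word_val q1) <= c].
Proof.
move=> wE Rs Rt.
have [|q [qE sq qfree qc]] := @subgroup_word ((y * word_val t)^-1 * (x * word_val s)).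
  by rewrite gpredMl ?gpredV.
exists q; split=> //.
- by rewrite !word_val_cat qE word_val_inv -wE !invgM !mulgA mulgK mulgK mulgVK mulgV.
- apply: leq_trans sq _; rewrite leq_mul2l ltnS; apply/orP; right.
  rewrite -wE !invgM -!mulgA mulKg !mulgA.
  have := lenM genS ((word_val t)^-1 * (word_val w)^-1) (word_val s).
  have := lenM genS (word_val t)^-1 (word_val w)^-1; rewrite !lenV //.
  have := word_length_word t; have := word_length_word s; have := word_length_word w.
  by move: (len _) (len _) (len _) (len _) (len _) => *; lia.
- move=> q1 q2 /qc; apply: leq_trans.
  exact: subgroup_distance_translate.
Qed.

Lemma geodesic_near_subgroup : exists D0, forall u1 u2,
  geodesic (u1 ++ u2) -> word_val (u1 ++ u2) \in R -> dist (word_val u1) <= D0.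
Proof.
have [C CP] := area_isoperimetry finX hypG.
(* With D = E + c the loop has length at most 6D + c(6D + 1) and area at least E^2. For E at least 1
   this gives E^2 at most M E. *)
pose M := (C * ((6 + 6 * c) * c.+1 + c))%N.
(* It is enough to bound the distance at a vertex where it is maximal along the geodesic. *)
suff main u1 u2 : geodesic (u1 ++ u2) -> word_val (u1 ++ u2) \in R ->
    (forall w1 w2, u1 ++ u2 = w1 ++ w2 -> dist (word_val w1) <= dist (word_val u1)) ->
    dist (word_val u1) <= c + M.
  exists (c + M)%N => u1 u2 geo Ru; set u := u1 ++ u2 in geo Ru.
  pose F (t : 'I_(size u).+1) := dist (word_val (take t u)).
  have [t _ tmax] := @arg_maxnP _ ord0 xpredT F isT.
  have umax w1 w2 : u = w1 ++ w2 -> dist (word_val w1) <= F t.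
    move=> uE; have wu : size w1 < (size u).+1 by rewrite uE size_cat ltnS leq_addr.
    have := tmax (Ordinal wu) isT; rewrite /F /=.
    by have -> : take (size w1) u = w1 by rewrite uE take_size_cat.
  apply: leq_trans (umax u1 u2 erefl) _.
  by apply: (main _ (drop t u)); rewrite cat_take_drop.
move=> geo Ru maxD; set D := dist (word_val u1) in maxD *.
have [cD|Dc] := leqP D c; first exact: leq_trans cD (leq_addr _ _).
(* The side [q] stays within [c] of [R], hence at distance at least [D - c] from [word_val u1]; a
   bump of this radius vanishes on it. *)
pose E := (D - c)%N.
(* [P1] and [Q] are the parts of the geodesic within [2D] of [word_val u1]. *)
pose A := take (size u1 - 2 * D)%N u1; pose P1 := drop (size u1 - 2 * D)%N u1.
pose Q := take (2 * D)%N u2; pose Z := drop (2 * D)%N u2.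
(* Along [P2] the bump is at least the number of edges left, which yields the area E^2. Elsewhere on
   the geodesic the area is nonnegative, since [f] increases there. *)
pose P2 := take E Q; pose P3 := drop E Q.
have u1E : u1 = A ++ P1 by rewrite cat_take_drop.
have u2E : u2 = Q ++ Z by rewrite cat_take_drop.
have QE : Q = P2 ++ P3 by rewrite cat_take_drop.
have [s [Rs geos ss]] := connecting_word genS R (word_val A).
have [t [Rt geot st]] := connecting_word genS R (word_val (u1 ++ Q)).
have [|q [loop sq _ qc]] :=
  @subgroup_polygon _ (word_val (u1 ++ Q)) (P1 ++ Q) s t _ Rs Rt.
  by rewrite -word_val_cat catA -u1E.
have DA : dist (word_val A) <= D by apply: (maxD _ (P1 ++ u2)); rewrite catA -u1E.
have DQ : dist (word_val (u1 ++ Q)) <= D by apply: (maxD _ Z); rewrite -catA -u2E.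
have u1R : D <= size u1.
  have := @subgroup_distance_le G X m H R (word_val u1) 1 gpred1.
  by rewrite mulg1 lenV // => /leq_trans; apply; exact: word_length_word.
have u2R : D <= size u2.
  have := subgroup_distance_le X H (word_val u1) Ru.
  by rewrite word_val_cat mulKg => /leq_trans; apply; exact: word_length_word.
have sP2 : size P2 = E.
  by rewrite !size_take_min; rewrite /E; lia.
have sPQ : size (P1 ++ Q) <= 4 * D.
  by rewrite size_cat size_drop size_take_min; lia.
pose f x := Posz (len x).
pose h x := Posz (E - len ((word_val u1)^-1 * x)).
have := CP f h (lipschitz_len genS) (lipschitz_bump genS _ _) (word_val A) _ loop.
have fprefix w1 w2 w3 : u1 ++ u2 = w1 ++ w2 ++ w3 ->
    forall v1 v2, w2 = v1 ++ v2 ->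
    f (word_val w1 * word_val v1) = (f (word_val w1) + (size v1)%:Z)%R.
  move=> uE v1 v2 wE; move: geo; rewrite uE wE -!catA => geo.
  have := geodesic_catl genS geo; move: geo; rewrite catA => /(geodesic_catl genS).
  rewrite /geodesic /f size_cat word_val_cat => <- <-; lia.
have h_connector x (r : seq (letter X H)) : x * word_val r \in R -> geodesic r ->
  size r = dist x -> dist x <= D ->
  D <= len ((word_val u1)^-1 * x) - D \/ x \in R ->
  area_sum f h x r = 0%R.
  move=> Rr geor sr xD far; apply: area_sum_eq0 => w1 w2 rE.
  have := connecting_word_far genS far erefl xD sr rE.
  by rewrite /h /E -/D; move: (len _) => n; lia.
have h_ge0 x : (0 <= h x)%R by [].
have hQ : (E%:Z * E%:Z <= area_sum f h (word_val u1) Q)%R.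
  rewrite QE area_sum_cat -word_val_cat.
  have := area_sum_ge0 (fprefix (u1 ++ P2) P3 Z _) h_ge0.
  rewrite u2E QE -!catA => /(_ erefl).
  suff : (E%:Z * E%:Z <= area_sum f h (word_val u1) P2)%R by lia.
  rewrite -sP2; apply: area_sum_sqr => [|w1 w2 wE].
    by apply: (fprefix u1 P2 (P3 ++ Z)); rewrite u2E QE -!catA.
  rewrite /h mulKg lez_nat -sP2 wE size_cat.
  by have := word_length_word w1; lia.
have hP1 := area_sum_ge0 (fprefix A P1 u2 _) h_ge0.
have {}hP1 := hP1 (etrans (congr1 (cat^~ u2) u1E) (esym (catA _ _ _))).
(* Either [Q] reaches the end of the geodesic, which lies in [R], or its end is at distance exactly
   2D from [word_val u1]. *)
have ht : area_sum f h (word_val (u1 ++ Q)) t = 0%R.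
  apply: h_connector => //; have [lt_u2|le_u2] := ltnP (size u2) (2 * D).
    by right; rewrite /Q take_oversize // ltnW.
  left; rewrite word_val_cat mulKg.
  have : geodesic Q.
    by move: geo; rewrite u2E => /(geodesic_catr genS)/(geodesic_catl genS).
  by rewrite /geodesic => <-; rewrite size_takel // mul2n -addnn addnK.
have hs : area_sum f h (word_val A) s = 0%R.
  apply: h_connector => //; have [lt_u1|le_u1] := ltnP (size u1) (2 * D).
    right; rewrite /A (_ : size u1 - 2 * D = 0)%N ?take0 ?word_val_nil ?gpred1 //; lia.
  left; rewrite u1E lenC // word_val_cat mulKg.
  have : geodesic P1.
    by move: geo; rewrite u1E -catA => /(geodesic_catr genS)/(geodesic_catl genS).
  by rewrite /geodesic => <-; rewrite size_drop; lia.
have hq : area_sum f h (word_val (u1 ++ Q) * word_val t) q = 0%R.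
  apply: area_sum_eq0 => q1 q2 /qc qc1.
  have := subgroup_distance_lipschitz genS R (word_val u1)
            (word_val (u1 ++ Q) * word_val t * word_val q1).
  by rewrite /h /E -/D; move: qc1; move: (dist _) (len _) => *; lia.
have bound : (area_sum f h (word_val A) ((P1 ++ Q) ++ t ++ q ++ word_inv s) =
    area_sum f h (word_val A) P1 + area_sum f h (word_val u1) Q)%R.
  rewrite -catA !area_sum_cat -(word_val_cat A) -u1E -(word_val_cat u1).
  rewrite ht hq area_sum_inv (_ : _ * word_val (word_inv s) = word_val A).
    by rewrite hs; lia.
  move: loop; rewrite -!catA !word_val_cat u1E word_val_cat !mulgA => loop.
  by rewrite -!mulgA -[RHS]mulg1 -loop !mulgA.
rewrite bound !size_cat size_word_inv; move: hP1 hQ => hP1 hQ le_area.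
have DE : D = (E + c)%N by rewrite /E; lia.
rewrite DE addnC leq_add2l.
rewrite size_cat in sPQ; rewrite size_cat in sq.
have : (E * E <= C * (6 * D + c * (6 * D).+1))%N.
  have sq' : (size q <= c * (6 * D).+1)%N.
    by apply: leq_trans sq _; rewrite leq_mul2l; apply/orP; right; lia.
  have : (size P1 + size Q + (size t + (size q + size s)) <=
          6 * D + c * (6 * D).+1)%N by lia.
  move/(leq_mul (leqnn C)); move: le_area hP1 hQ.
  by move: (area_sum _ _ _ _) (area_sum _ _ _ _) (C * _)%N (C * _)%N => *; lia.
rewrite DE; case: (posnP E) => [->//|E0] leE.
rewrite -(leq_pmul2l E0); apply: leq_trans leE _.
rewrite /M mulnCA leq_mul2l; apply/orP; right; nia.
Qed.

Lemma word_val_rot v w : word_val (v ++ w) = 1 -> word_val (w ++ v) = 1.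
Proof. by rewrite !word_val_cat => /mulg1_eq <-; rewrite mulVg. Qed.

(** Parabolic elements have relative length at most 1, and [w1] is too short to get there from
    [z]. *)
Lemma notin_parabolic i z w1 : size w1 + 1 < len z -> z * word_val w1 \notin H i.
Proof.
move=> far; apply/negP => /(parabolic_length X) le1.
have := lenM genS (z * word_val w1) (word_val w1)^-1; rewrite mulgK lenV //.
have := word_length_word w1; move: far le1.
by move: (len _) (len _) (len _) => *; lia.
Qed.

Lemma parabolic_free_no_component q q1 q2 i k :
  parabolic_free q -> q = q1 ++ Par (i := i) X k :: q2 -> False.
Proof. by move=> qfree qE; have := qfree i k; rewrite qE mem_cat mem_head orbT. Qed.

Lemma geodesic_components_bounded : exists (Omega : set G) (B : nat),
  finite_set Omega /\
  forall u v, geodesic (u ++ v) -> word_val (u ++ v) \in R ->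
  exists s, [/\ word_val u * word_val s \in R, size s <= B &
    forall s1 i h s2, s = s1 ++ Par (i := i) X h :: s2 ->
      in_ball (Omega `&` [set` H i]) B (val h)].
Proof.
have [D nearR] := geodesic_near_subgroup.
have [Omega [C [finO iso]]] := isolated_component finX hypG.
(* The geodesic is cut [K1] edges before and after the component, so that connecting words of length
   at most [D] starting there cannot reach its coset. [N1] bounds the side [q]. *)
pose K1 := D.+2; pose N1 := (c * (2 * K1 + 1 + 2 * D).+1)%N.
pose B1 := (C * (2 * K1 + 2 * D + N1).+1)%N.
(* First the parabolic edges of the geodesic itself. On the loop such an edge is alone in its coset,
   so [b = 0] will do. *)
have component u1 i h u2 : geodesic (u1 ++ Par (i := i) X h :: u2) ->
    word_val (u1 ++ Par X h :: u2) \in R ->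
    in_ball (Omega `&` [set` H i]) B1 (val h).
  move=> geo Ru.
  pose A := take (size u1 - K1)%N u1; pose P := drop (size u1 - K1)%N u1.
  pose Q := take K1 u2; pose Z := drop K1 u2.
  have u1E : u1 = A ++ P by rewrite cat_take_drop.
  have u2E : u2 = Q ++ Z by rewrite cat_take_drop.
  have sP : size P <= K1 by rewrite size_drop; lia.
  have sQ : size Q <= K1 by rewrite size_take_min; lia.
  have [s [Rs geos ss]] := connecting_word genS R (word_val A).
  have [t [Rt geot st]] := connecting_word genS R (word_val (u1 ++ Par X h :: Q)).
  have [|q [loop sq qfree _]] :=
    @subgroup_polygon _ (word_val (u1 ++ Par X h :: Q)) (P ++ Par X h :: Q) s t _ Rs Rt.
    by rewrite -word_val_cat catA -u1E.
  have sD : size s <= D.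
    by rewrite ss; apply: (nearR _ (P ++ Par X h :: u2)); rewrite catA -u1E.
  have tD : size t <= D.
    by rewrite st; apply: (nearR _ Z); rewrite -catA /= -u2E.
  have geoP : geodesic (P ++ Par X h :: Q).
    move: geo; rewrite u1E u2E -catA => /(geodesic_catr genS).
    by rewrite -cat_cons catA => /(geodesic_catl genS).
  have loop' : val h * word_val (Q ++ t ++ q ++ word_inv s ++ P) = 1.
    have := @word_val_rot P (Par X h :: Q ++ t ++ q ++ word_inv s).
    rewrite -cat_cons catA => /(_ loop).
    by rewrite -!catA /= word_val_cons.
  suff : in_ball (Omega `&` [set` H i])
      (C * (size (Q ++ t ++ q ++ word_inv s ++ P)).+1 + 0)%N (val h).
    case=> w wh sw; exists w => //; apply: leq_trans sw _.
    rewrite addn0 leq_mul2l; apply/orP; right.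
    move: sq; rewrite !size_cat /= size_word_inv => sq.
    have : (size q <= N1)%N.
      by apply: leq_trans sq _; rewrite leq_mul2l; apply/orP; right; lia.
    by lia.
  apply: iso => // P0 [P0L P0out]; rewrite !coset_sum_cat coset_sum_inv.
  (* This is the vertex where [s] starts; since the loop closes at 1 through [P], it is the inverse
     of [word_val P]. *)
  set gs := _ * word_val q * _.
  have gsE : gs = (word_val P)^-1.
    apply/esym/mulg1_eq; rewrite /gs !mulgA.
    by move: loop; rewrite -catA /= word_val_cat word_val_cons !word_val_cat !mulgA.
  rewrite gsE.
  rewrite (coset_sum_isolated P0out (w := Q)); last first.
    move=> w1 k w2 QE; move: geoP; rewrite QE => /geodesic_no_backtracking out.
    by have /andP[Hh _] := valP h; rewrite gpredMl // out.
  rewrite (coset_sum_isolated P0out (w := t)); last first.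
    move=> w1 k w2 tE; apply: notin_parabolic.
    have [lt_u2|le_u2] := ltnP (size u2) K1.
      have QE : Q = u2 by rewrite /Q take_oversize // ltnW.
      by move: st; rewrite QE subgroup_distance_eq0 // tE size_cat /= addnS.
    have /(geodesic_catr genS) := geoP; rewrite /geodesic word_val_cons /= => <-.
    by rewrite size_takel // /K1; move: tD; rewrite tE size_cat /=; lia.
  rewrite (coset_sum_isolated P0out (w := q)); last first.
    by move=> w1 k w2 /(parabolic_free_no_component qfree).
  rewrite (coset_sum_isolated P0out (w := s)); last first.
    move=> w1 k w2 sE; apply: notin_parabolic; rewrite lenV //.
    have [lt_u1|le_u1] := ltnP (size u1) K1.
      move: ss; rewrite subgroup_distance_eq0 ?sE ?size_cat /= ?addnS //.
      by rewrite /A (_ : size u1 - K1 = 0)%N ?take0 ?word_val_nil ?gpred1 //; lia.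
    have /(geodesic_catl genS) := geoP; rewrite /geodesic => <-.
    by rewrite size_drop; move: sD; rewrite sE size_cat /K1 /=; lia.
  rewrite (coset_sum_isolated P0out (w := P)) //.
  move=> w1 k w2 PE; rewrite PE word_val_cat invgM mulgVK gpredV word_val_cons.
  have /andP[Hk _] := valP k; rewrite gpredMl //.
  move: geoP; rewrite PE -catA => /(geodesic_catr genS).
  exact: (geodesic_no_backtracking genS (u := [::])).
(* Now the edges of the connecting word [s]. Walking [K2] along the geodesic leads more than [D]
   away from any vertex of [s], out of reach for the next connecting word [t]. The edges of [Q] may
   lie in the coset of [h], which costs the term [B1 * K2]. *)
pose K2 := (2 * D + 2)%N; pose N2 := (c * (K2 + 2 * D).+1)%N.
pose B2 := (C * (K2 + 2 * D + N2).+1 + B1 * K2)%N.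
exists Omega, (D + B2)%N; split=> // u1 u2 geo Ru.
have [s [Rs geos ss]] := connecting_word genS R (word_val u1).
have sD : size s <= D by rewrite ss; exact: nearR geo Ru.
exists s; split=> //; first exact: leq_trans sD (leq_addr _ _).
move=> s1 i h s2 sE.
pose Q := take K2 u2; pose Z := drop K2 u2.
have u2E : u2 = Q ++ Z by rewrite cat_take_drop.
have sQ : size Q <= K2 by rewrite size_take_min; lia.
have [t [Rt geot st]] := connecting_word genS R (word_val (u1 ++ Q)).
have tD : size t <= D by rewrite st; apply: (nearR _ Z); rewrite -catA -u2E.
have [|q [loop sq qfree _]] :=
  @subgroup_polygon (word_val (u1 ++ Q)) (word_val u1) (word_inv Q) t s _ Rt Rs.
  by rewrite word_val_cat word_val_inv mulgK.
have geoQ : geodesic Q.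
  by move: geo; rewrite u2E => /(geodesic_catr genS)/(geodesic_catl genS).
pose w0 := s2 ++ q ++ word_inv t ++ word_inv Q ++ s1.
have loop' : val h * word_val w0 = 1.
  have := @word_val_rot (word_inv Q ++ s1) (Par X h :: s2 ++ q ++ word_inv t).
  rewrite -!catA sE -!catA /= in loop *; move=> /(_ loop).
  by rewrite -!catA /= word_val_cons.
suff : in_ball (Omega `&` [set` H i]) (C * (size w0).+1 + B1 * K2)%N (val h).
  case=> w wh sw; exists w => //; apply: leq_trans sw _.
  apply: leq_trans (leq_addl D _); rewrite leq_add2r leq_mul2l; apply/orP; right.
  have qN : (size q <= N2)%N.
    apply: leq_trans sq _; rewrite size_word_inv leq_mul2l; apply/orP; right; lia.
  by move: sD; rewrite sE /w0 !size_cat !size_word_inv /=; lia.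
apply: iso => // P0 [P0L P0out]; rewrite !coset_sum_cat !coset_sum_inv.
set gt := _ * word_val q * _; set gQ := gt * _.
have gQE : gQ = (word_val s1)^-1.
  apply/esym/mulg1_eq; rewrite /gQ /gt !mulgA.
  have := word_val_rot (v := Par X h :: s2 ++ q ++ word_inv t ++ word_inv Q) (w := s1).
  rewrite /= -!catA word_val_cons => /(_ loop').
  by rewrite word_val_cat word_val_cons !word_val_cat !mulgA.
have gtE : gt = (word_val s1)^-1 * word_val Q.
  by rewrite -gQE /gQ word_val_inv mulgVK.
rewrite gQE gtE.
rewrite (coset_sum_isolated P0out (w := s2)); last first.
  move=> w1 k w2 s2E; move: geos; rewrite sE s2E => /(geodesic_no_backtracking genS) out.
  by have /andP[Hh _] := valP h; rewrite gpredMl // out.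
rewrite (coset_sum_isolated P0out (w := q)); last first.
  by move=> w1 k w2 /(parabolic_free_no_component qfree).
rewrite (coset_sum_isolated P0out (w := t)); last first.
  move=> w1 k w2 tE; apply: notin_parabolic.
  have [lt_u2|le_u2] := ltnP (size u2) K2.
    have QE : Q = u2 by rewrite /Q take_oversize // ltnW.
    by move: st; rewrite QE subgroup_distance_eq0 // tE size_cat /= addnS.
  have := lenM genS (word_val s1) ((word_val s1)^-1 * word_val Q).
  rewrite mulVKg -geoQ size_takel // /K2; have := word_length_word s1.
  move: sD tD; rewrite sE tE !size_cat /=; move: (len _) (len _) => *; lia.
rewrite (coset_sum_isolated P0out (w := s1)); last first.
  move=> w1 k w2 s1E; rewrite s1E word_val_cat invgM mulgVK gpredV word_val_cons.
  have /andP[Hk _] := valP k; rewrite gpredMl //.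
  move: geos; rewrite sE s1E -catA => /(geodesic_catr genS).
  exact: (geodesic_no_backtracking genS (u := [::])).
rewrite oppr0 addr0 !add0r normrN.
(* Only [Q] is left. Its parabolic edges are edges of the geodesic, so each changes the potential by
   at most [B1] by the first stage. *)
apply: le_trans (coset_sum_le (B := B1) _) _; last by rewrite lez_nat leq_mul2l sQ orbT.
move=> w1 k w2 QE; apply: in_ball_lipschitz P0L _ _.
apply: (component (u1 ++ w1) _ _ (w2 ++ Z)).
  by move: geo; rewrite u2E QE -!catA.
by move: Ru; rewrite u2E QE -!catA.
Qed.

End QuasiIsometricSubgroup.

(** * Translation between Cayley paths and words *)

Section CayleyPaths.
Local Open Scope classical_set_scope.
Local Open Scope group_scope.
Context {G : groupType} (X : set G) {m : nat} (H : 'I_m -> groupClosed G).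
Notation S := (relative_generators H X).
Implicit Types (u v w : seq (letter X H)).

Lemma cayley_path_of_word a u : exists p,
  [/\ cayley_path S a (a * word_val u) p, size p = size u &
      forall u1 u2, u = u1 ++ u2 -> a * word_val u1 \in a :: p].
Proof.
elim: u a => [|l u IHu] a.
  exists [::]; split=> //; first by split=> //=; rewrite word_val_nil mulg1.
  by case=> // u2 _; rewrite word_val_nil mulg1 mem_head.
have [p [[pp lp] sp pin]] := IHu (a * letter_val l).
exists (a * letter_val l :: p); split=> /=; last 2 first.
- by rewrite sp.
- case=> [|l' u1] u2; first by rewrite word_val_nil mulg1 mem_head.
  by case=> <- /pin; rewrite word_val_cons mulgA => pu; rewrite inE pu orbT.
split; last by rewrite /= lp word_val_cons mulgA.
rewrite /= pp andbT; apply/asboolP; rewrite mulKg invgM mulgVK.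
exact: letter_generator.
Qed.

Lemma word_of_cayley_path a p : path (cayley S) a p ->
  exists u, a * word_val u = last a p /\ size u <= size p.
Proof.
elim: p a => [|b p IHp] a /=; first by exists [::]; rewrite word_val_nil mulg1.
case/andP => /asboolP Sab /IHp[u [uE su]].
have [|w [wE sw]] := @generator_letter G X m H (a^-1 * b).
  by rewrite invgM invgK.
exists (w ++ u); rewrite word_val_cat wE !mulgA mulgV mul1g uE size_cat; split=> //.
by rewrite -add1n leq_add.
Qed.

Hypothesis genS : generated S = setT.

Lemma geodesic_word_through f g p x : cayley_geodesic S f g p -> x \in f :: p ->
  exists u1 u2, [/\ geodesic (u1 ++ u2), f * word_val u1 = x &
                    f * word_val (u1 ++ u2) = g].
Proof.
case=> -[] pp gE pmin xp; case/splitPl: xp pp gE pmin => p1 p2 lp1.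
rewrite cat_path last_cat lp1 => /andP[pp1 pp2] gE pmin.
have [u1 [u1E su1]] := word_of_cayley_path pp1.
have [u2 [u2E su2]] := word_of_cayley_path pp2.
have fE : f * word_val (u1 ++ u2) = g by rewrite word_val_cat mulgA u1E lp1 u2E.
exists u1, u2; split=> //; last by rewrite u1E.
have [w [wE sw]] := len_geodesic genS (f^-1 * g).
have [q [qp sq _]] := cayley_path_of_word f w.
move: qp; rewrite wE mulVKg => /pmin; rewrite size_cat sq sw -fE mulKg => le_p.
by apply/eqP; rewrite eqn_leq word_length_word andbT (leq_trans _ le_p) //
  size_cat leq_add.
Qed.

End CayleyPaths.

Section GenWords.
Local Open Scope classical_set_scope.
Local Open Scope group_scope.
Context {G : groupType} (X : set G) {m : nat} (H : 'I_m -> groupClosed G).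

Lemma parabolic_free_word g : generated X g ->
  exists q : seq (letter X H), word_val q = g /\ parabolic_free q.
Proof.
case=> w [Xw <-]; elim: w Xw => [|s w IHw] Xw.
  by exists [::]; rewrite word_val_nil big_nil.
have [|q [qE qfree]] := IHw; first by move=> t tw; apply: Xw; rewrite inE tw orbT.
have [l [lE lfree]] : exists l : letter X H,
    letter_val l = s /\ forall i h, Par (i := i) X h != l.
  case: (Xw s (mem_head _ _)) => Xs.
    by exists (Gen H (exist _ s (mem_set Xs) : X) false); split=> // i h; apply/eqP.
  exists (Gen H (exist _ s^-1 (mem_set Xs) : X) true).
  by split=> [|i h]; [rewrite /= invgK|apply/eqP].
exists (l :: q); rewrite word_val_cons lE qE big_cons; split=> // i h.
by rewrite inE negb_or lfree qfree.
Qed.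

(** A parabolic letter is a product of at most [B] elements of [Omega] or their inverses, each of
    length at most [k]; any other letter has length at most 1. *)
Lemma word_length_components (Omega : set G) (k B : nat) (s : seq (letter X H)) :
  generated X = setT -> (forall x, Omega x -> word_length X x <= k) ->
  (forall s1 i h s2, s = s1 ++ Par (i := i) X h :: s2 ->
     in_ball (Omega `&` [set` H i]) B (val h)) ->
  word_length X (word_val s) <= (k * B + 1) * size s.
Proof.
move=> genX kP; have XT x : generated X x by rewrite genX.
elim: s => [|l s IHs] sB; first by rewrite word_val_nil word_length1.
rewrite word_val_cons /= mulnS; apply: leq_trans (word_lengthM (XT _) (XT _)) _.
apply: leq_add; last first.
  by apply: IHs => s1 i h s2 sE; apply: (sB (l :: s1) i h s2); rewrite sE.
case: l sB => [x b|i h] sB /=.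
  rewrite (leq_trans _ (leq_addl _ _)) //.
  suff : word_length X (val x) <= 1 by case: b {sB} => //; rewrite word_lengthV.
  by apply: (@word_length_le _ X [:: val x]); apply: spells1; left; exact: set_valP.
have [w [Ow <-] wB] := sB [::] i h s erefl.
apply: leq_trans (leq_addr _ _); apply: leq_trans (_ : k * size w <= _); last first.
  by rewrite leq_mul2l wB orbT.
elim: w Ow {wB} => [|x w IHw] Ow; first by rewrite big_nil word_length1.
rewrite big_cons mulnS; apply: leq_trans (word_lengthM (XT _) (XT _)) _.
apply: leq_add; last by apply: IHw => t tw; apply: Ow; rewrite inE tw orbT.
by case: (Ow x (mem_head _ _)) => -[/kP]; rewrite ?word_lengthV.
Qed.
End GenWords.

Section MainDirections.
Local Open Scope classical_set_scope.
Local Open Scope group_scope.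
Context {K : realType} {G : groupType} (X : set G) {m : nat} (H : 'I_m -> groupClosed G).
Hypothesis (finX : finite_set X) (genX : generated X = setT).
Context (R : groupClosed G).
Notation S := (relative_generators H X).
Notation len := (word_length S).
Implicit Types (u v q : seq (letter X H)) (g x y z : G).

Lemma relative_generators_generate : generated S = setT.
Proof.
apply/seteqP; split=> // g _; have : generated X g by rewrite genX.
by case=> w /(@spells_sub _ X S) wS; exists w; apply: wS => x; left.
Qed.
Let genS := relative_generators_generate.

(** * From a quasi-isometric embedding to strong quasi-convexity *)

Section FromQuasiIsometry.
Hypothesis hypG : relatively_hyperbolic K H.
Context (Y : set G) (N : nat).
Hypothesis (finY : finite_set Y) (genY : generated Y = [set` R]).
Hypothesis le_len : forall r, r \in R -> word_length Y r <= N * (len r).+1.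

(** Spell [r] over [Y] and replace each letter by a fixed word over [X]. A prefix ends within one
    such replacement of an element of [R]. *)
Lemma subgroup_words : exists c : nat, forall r, r \in R -> exists q,
  [/\ word_val q = r, size q <= c * (len r).+1, parabolic_free q &
      forall q1 q2, q = q1 ++ q2 -> subgroup_distance X H R (word_val q1) <= c].
Proof.
have /choice[t tP] : forall g, exists q : seq (letter X H),
    word_val q = g /\ parabolic_free q.
  by move=> g; apply: parabolic_free_word; rewrite genX.
have [k kP] : exists k, forall y, Y y \/ Y y^-1 -> size (t y) <= k.
  have finY' : finite_set (Y `|` [set y^-1 | y in Y]).
    by rewrite finite_setU; split=> //; exact: finite_image.
  have [k kP] := finite_set_bounded (size \o t) finY'.
  exists k => y Yy; apply: (kP y).
  by case: Yy => Yy; [left|right; exists y^-1; rewrite ?invgK].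
have YR y : Y y \/ Y y^-1 -> y \in R.
  have YR' z : Y z -> z \in R.
    move=> Yz; have : generated Y z by exists [:: z]; apply: spells1; left.
    by rewrite genY.
  by case=> /YR' //; rewrite gpredV.
(* The term [k * N] serves the length of the word, and [k] the distance of its prefixes to [R]. *)
exists (k * N + k)%N => r Rr.
have /word_lengthP[w [Yw wr] ws] : generated Y r by rewrite genY.
exists (flatten (map t w)).
have flat_val : word_val (flatten (map t w)) = \prod_(y <- w) y.
  elim: w {Yw wr ws} => [|y w IHw]; first by rewrite big_nil word_val_nil.
  by rewrite big_cons /= word_val_cat IHw (tP y).1.
have flat_size : size (flatten (map t w)) <= k * size w.
  elim: w {flat_val wr ws} Yw => [|y w IHw] Yw //=; rewrite size_cat mulnS leq_add //.
    by apply/kP/Yw; rewrite inE eqxx.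
  by apply: IHw => z zw; apply: Yw; rewrite inE zw orbT.
split; first by rewrite flat_val.
- apply: leq_trans flat_size _; rewrite mulnDl -mulnA.
  apply: leq_trans (leq_addr _ _); rewrite leq_mul2l; apply/orP; right.
  by rewrite ws le_len.
- move=> i h; elim: w {Yw wr ws flat_val flat_size} => //= y w IHw.
  by rewrite mem_cat negb_or IHw (tP y).2.
- elim: w Yw {wr ws flat_val flat_size} => [|y w IHw] Yw q1 q2 /=.
    case: q1 => // _; rewrite word_val_nil subgroup_distance_eq0 ?gpred1 //.
  have Ry : y \in R by apply/YR/Yw; rewrite inE eqxx.
  have ky : size (t y) <= k by apply/kP/Yw; rewrite inE eqxx.
  have /IHw {}IHw : word_over Y w by move=> z zw; apply: Yw; rewrite inE zw orbT.
  have [lt_q1|le_q1] := leqP (size q1) (size (t y)) => qE.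
    have := @subgroup_distance_le G X m H R (word_val q1) 1 gpred1.
    rewrite mulg1 lenV // => /leq_trans; apply; apply: leq_trans (word_length_word _) _.
    by rewrite (leq_trans lt_q1) // (leq_trans ky) // leq_addl.
  have [q' q1E] : exists q', q1 = t y ++ q'.
    exists (drop (size (t y)) q1); have := congr1 (take (size (t y))) qE.
    by rewrite take_size_cat // takel_cat 1?ltnW // => {1}->; rewrite cat_take_drop.
  move: qE; rewrite q1E -catA => /eqP; rewrite eqseq_cat // eqxx /= => /eqP qE.
  have := subgroup_distance_translate genS (word_val q') Ry.
  rewrite word_val_cat (tP y).1 => /leq_trans; apply; exact: IHw qE.
Qed.

Lemma quasiisometric_quasiconvex : relatively_quasiconvex K H X R.
Proof.
have [c words] := subgroup_words.
have [Omega [B [finO comp]]] := geodesic_components_bounded finX hypG genS words.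
have [k kP] := finite_set_bounded (word_length X) finO.
(* The connecting word has at most [B] letters, each of length at most [k * B + 1] over [X]; the
   successor makes sigma positive. *)
exists ((k * B + 1) * B).+1%:R%R => [|f g p v Rf Rg geo vp]; first by rewrite ltr0n.
have [u1 [u2 [geou vE gE]]] := geodesic_word_through genS geo vp.
have Ru : word_val (u1 ++ u2) \in R by rewrite -(gpredMl _ Rf) gE.
have [s [Rs sB sO]] := comp u1 u2 geou Ru.
exists (f * (word_val u1 * word_val s)); first by rewrite gpredM.
rewrite /word_dist -vE invgM -!mulgA mulKg mulKg ler_nat.
apply/leqW; apply: leq_trans (word_length_components genX kP sO) _.
by rewrite leq_mul2l sB orbT.
Qed.

(** A conjugate by [g] of an element of [H i] has relative length at most [2 * len g + 1], so those
    in [R] lie in one ball for the finite set [Y]. *)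
Lemma quasiisometric_finite_intersection i g :
  finite_set ([set` R] `&` [set h ^ g | h in [set` H i]]).
Proof.
apply: sub_finite_set (ball_finite (N * (len g + 1 + len g).+1) finY).
move=> r [Rr [h Hh rE]]; split; first by rewrite genY.
apply: leq_trans (le_len Rr) _; rewrite leq_mul2l ltnS; apply/orP; right.
rewrite -rE; apply: leq_trans (lenM genS _ _) _; rewrite lenV // -addnA leq_add2l.
by apply: leq_trans (lenM genS _ _) _; rewrite leq_add2r (parabolic_length X Hh).
Qed.

End FromQuasiIsometry.

(** * From strong quasi-convexity to a quasi-isometric embedding *)

Section FromQuasiConvexity.
Context (N : nat).
Hypothesis near : forall u1 u2, geodesic (u1 ++ u2) -> word_val (u1 ++ u2) \in R ->
  exists2 y, y \in R & word_length X ((word_val u1)^-1 * y) <= N.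
Hypothesis finRH : forall i g, finite_set ([set` R] `&` [set h ^ g | h in [set` H i]]).

(** A jump joins points of [R] near two consecutive vertices of a geodesic; [s = 1] admits the
    initial jump from 1 to a point near the origin. *)
Definition jumps : set G := [set y | y \in R /\ exists a b s,
  [/\ word_length X a <= N, word_length X b <= N, s = 1 \/ S s \/ S s^-1 &
      y = a^-1 * s * b]].

Lemma jumps_finite : finite_set jumps.
Proof.
pose ball := [set g | generated X g /\ word_length X g <= N].
have finB : finite_set ball by exact: ball_finite.
pose T0 := [set 1] `|` (X `|` [set x^-1 | x in X]).
have finT0 : finite_set T0.
  by rewrite !finite_setU; split; [exact: finite_set1|split=> //; exact: finite_image].
pose J a b := [set a^-1 * s * b | s in T0] `|`
  \bigcup_(i in [set: 'I_m]) ([set` R] `&` [set a^-1 * h * b | h in [set` H i]]).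
have finJ a b : finite_set (J a b).
  rewrite finite_setU; split; first exact: finite_image.
  apply: bigcup_finite => [|i _]; first exact: finite_finset.
  (* Relative to one jump [y0], any other jump [y] with the same [a], [b], [i] has [y * y0^-1] in
     [R] and in the conjugate of [H i] by [a], a finite intersection. *)
  have [[y0 [Ry0 [h0 Hh0 y0E]]]|none] := pselect
    (exists y0, ([set` R] `&` [set a^-1 * h * b | h in [set` H i]]) y0); last first.
    by apply: sub_finite_set (finite_set0 G) => y yP; apply: none; exists y.
  apply: sub_finite_set (finite_image (fun z => z * y0) (finRH i a)).
  move=> y [Ry [h Hh yE]]; exists ((h * h0^-1) ^ a); last first.
    by rewrite -y0E -yE conjgE !mulgA mulgK mulgVK.
  split; last by exists (h * h0^-1) => //=; rewrite gpredMr ?gpredV.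
  have -> : (h * h0^-1) ^ a = y * y0^-1.
    by rewrite -y0E -yE conjgE !invgM invgK !mulgA mulgK.
  by rewrite /= gpredMr ?gpredV.
have := bigcup_finite finB (fun a _ => bigcup_finite finB (fun b _ => finJ a b)).
apply: sub_finite_set => y [Ry [a [b [s [aN bN sS yE]]]]].
exists a; first by split=> //; rewrite genX.
exists b; first by split=> //; rewrite genX.
case: sS => [s1|[[Xs|[i _ His]]|[Xs|[i _ His]]]].
- by left; exists s => //; left.
- by left; exists s => //; right; left.
- by right; exists i => //; split=> //; exists s.
- by left; exists s => //; right; right; exists s^-1; rewrite ?invgK.
- by right; exists i => //; split=> //; exists s => //; rewrite /= -gpredV.
Qed.

Lemma jumps_word r : r \in R -> exists2 w, spells jumps w r & size w <= (len r).+1.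
Proof.
move=> Rr; have [u [uE su]] := len_geodesic genS r; rewrite -su.
have geou : geodesic u by rewrite /geodesic uE.
(* Induction on prefixes, for an arbitrary point [y] of [R] near the end of the prefix; the full
   geodesic allows [y = r]. *)
suff main u1 u2 y : u = u1 ++ u2 -> y \in R ->
    word_length X ((word_val u1)^-1 * y) <= N ->
    exists2 w, spells jumps w y & size w <= (size u1).+1.
  apply: (main u [::]); rewrite ?cats0 // uE mulVg word_length1 //.
elim/last_ind: u1 u2 y => [|u1 l IHu] u2 y uE' Ry yN.
  exists [:: y] => //; apply: spells1; left; split=> //.
  move: yN; rewrite word_val_nil invg1 mul1g => yN.
  exists 1, y, 1; rewrite word_length1 invg1 !mul1g; split=> //; by left.
rewrite cat_rcons in uE'.
have [||y' Ry' y'N] := near (u1 := u1) (u2 := l :: u2); rewrite -?uE' ?uE //.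
have [w wy' sw] := IHu _ _ uE' Ry' y'N.
exists (w ++ [:: y'^-1 * y]); last by rewrite size_cat size_rcons addn1 ltnS.
rewrite -[y](mulVKg y'); apply: spells_cat wy' _; rewrite mulVKg.
apply: spells1; left; split; first by rewrite gpredMl ?gpredV.
exists ((word_val u1)^-1 * y'), ((word_val (rcons u1 l))^-1 * y), (letter_val l).
split=> //; first by right; exact: letter_generator.
by rewrite -cats1 word_val_cat word_val1 !invgM invgK !mulgA !mulgK.
Qed.

Lemma jumps_generate : generated jumps = [set` R].
Proof.
apply/seteqP; split; first by apply: generated_sub_group => y [].
by move=> r /jumps_word[w wr _]; exists w.
Qed.

End FromQuasiConvexity.

Lemma len_le_word_length (Y : set G) k g :
  (forall y, Y y -> len y <= k) -> generated Y g -> len g <= k * word_length Y g.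
Proof.
move=> Yk /word_lengthP[w [Yw <-] <-]; elim: w Yw => [|y w IHw] Yw.
  by rewrite big_nil word_length1.
rewrite big_cons mulnS; apply: leq_trans (lenM genS _ _) _; apply: leq_add.
  by case: (Yw y (mem_head _ _)) => /Yk //; rewrite lenV.
by apply: IHw => z zw; apply: Yw; rewrite inE zw orbT.
Qed.

End MainDirections.

Local Open Scope classical_set_scope.
Local Open Scope ring_scope.

Theorem theorem1p9 (K : realType) (G : groupType) (X : set G) (m : nat)
    (H : 'I_m -> groupClosed G) (R : groupClosed G) :
  finite_set X -> generated X = setT -> relatively_hyperbolic K H ->
  strongly_relatively_quasiconvex K H X R <->
  exists Y : set G,
    [/\ finite_set Y, generated Y = [set` R] &
        quasi_isometric_embedding
          (fun x y : {x : G | x \in R} => (word_dist Y (val x) (val y))%:R : K)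
          (fun x y : G => (word_dist (relative_generators H X) x y)%:R : K)
          (fun x : {x : G | x \in R} => val x)].
Proof.
move=> finX genX hypG; have genS := relative_generators_generate H genX.
split.
  case=> -[sigma _ qc] finRH; have [N sigmaN] := nat_upper_bound sigma.
  have near (u1 u2 : seq (letter X H)) :
      geodesic (u1 ++ u2) -> word_val (u1 ++ u2) \in R ->
      exists2 y, y \in R & (word_length X ((word_val u1)^-1 * y)%g <= N)%N.
    move=> geo Ru; have [p [[pp lp] sp pin]] := cayley_path_of_word 1%g (u1 ++ u2).
    have [||y Ry yN] := qc 1%g (word_val (u1 ++ u2)) p (word_val u1) gpred1 Ru.
    - split=> [|q]; first by split=> //; rewrite lp mul1g.
      case=> /word_of_cayley_path[v [vE sv]]; rewrite -vE mul1g sp => vu.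
      by rewrite geo -vu (leq_trans _ sv) // word_length_word.
    - by have := pin u1 u2 erefl; rewrite mul1g.
    by exists y => //; rewrite -(ler_nat K); exact: le_trans yN sigmaN.
  have finJ := jumps_finite finX genX N finRH.
  have genJ := jumps_generate genX near.
  have [k kP] := finite_set_bounded (word_length (relative_generators H X)) finJ.
  exists (jumps X H R N); split=> //.
  (* One side is [jumps_word], whose extra initial jump is [c2 = 1]. The other holds with factor
     [k]; the successor makes [c1] at least 1. *)
  exists k.+1%:R, 1; split; rewrite ?ltr0n ?ltr01 // => -[x Rx] [y Ry].
  rewrite /word_dist /=; set r := (x^-1 * y)%g.
  have Rr : r \in R by rewrite gpredMl ?gpredV.
  have [w wr sw] := jumps_word genX near Rr.
  have le1 := leq_trans (word_length_le wr) sw.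
  have le2 := len_le_word_length genX kP (_ : generated _ r).
  split.
    rewrite lerBlDr; apply: (@le_trans _ _ (word_length (jumps X H R N) r)%:R).
      by rewrite ler_piMl ?ler0n // invf_le1 ?ler1n ?ltr0n.
    by rewrite natr1 ler_nat.
  apply: ler_wpDr => //; rewrite -natrM ler_nat.
  by apply: leq_trans (le2 _) _; rewrite ?genJ // leq_mul2r leqnSn orbT.
case=> Y [finY genY [c1 [c2 [c1_gt0 c2_gt0 qi]]]].
have [n1 c1n] := nat_upper_bound c1; have [n2 c2n] := nat_upper_bound c2.
(* The embedding gives at most c1 (l + c2), where l is the relative length, and n1 (l + n2) is at
   most n1 (n2 + 1) (l + 1). *)
have le_len r : r \in R -> (word_length Y r <= n1 * n2.+1 *
    (word_length (relative_generators H X) r).+1)%N.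
  move=> Rr; have [le_r _] := qi (exist _ 1%g gpred1) (exist _ r Rr).
  move: le_r; rewrite /word_dist /= invg1 !mul1g lerBlDr mulrC ler_pdivrMr // => le_r.
  set l := word_length (relative_generators H X) r in le_r *; rewrite -(ler_nat K).
  apply: le_trans le_r _.
  apply: (@le_trans _ _ ((l%:R + n2%:R) * n1%:R)).
    by apply: ler_pM; rewrite ?addr_ge0 ?ler0n ?lerD2l ?(ltW c1_gt0) ?(ltW c2_gt0).
  by rewrite -natrD -natrM ler_nat; nia.
split; first exact: (quasiisometric_quasiconvex finX genX hypG finY genY le_len).
exact: (quasiisometric_finite_intersection genX finY genY le_len).
Qed.
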